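(* Let $Y=\{0,1\}^{\mathbb{Z}}$ be the full $2$-shift, let $X$ and $Z$ be the subshifts described in the context, and let $W=X\times Y\times Z$ with the product shift $\sigma$. Then $(W,\sigma)$ has a characteristic measure. Moreover, it has a characteristic measure that is a measure of maximal entropy, i.e. a $\sigma$-invariant Borel probability measure $\mu$ with $\psi_*\mu=\mu$ for all $\psi\in\mathrm{Aut}(W)$ and $h_\mu(\sigma)=h_{\mathrm{top}}(W)$.
   Context: A subshift is a closed nonempty subset of $\mathcal{A}^{\mathbb{Z}}$ ($\mathcal{A}$ finite) invariant under the left shift $\sigma$; it is minimal if it has no nonempty proper subshift. Products of subshifts carry the product shift and are subshifts over the product alphabet. $\mathrm{Aut}(W)$ is the group of homeomorphisms of $W$ commuting with $\sigma$; a Borel probability measure $\mu$ on $W$ is characteristic if $\psi_*\mu=\mu$ for all $\psi\in\mathrm{Aut}(W)$. $\mathcal{L}(X)$ is the set of finite words occurring in elements of $X$. A minimal forbidden word of $X$ is a finite word not in $\mathcal{L}(X)$ all of whose proper subwords lie in $\mathcal{L}(X)$; $\mathcal{M}_n(X)$ is the set of those of length $n$. The SFT cover of a subshift $X$ is the sequence $(X_k)_{k\ge1}$ where $X_k$ is the set of $x\in\mathcal{A}^{\mathbb{Z}}$ in which no word of $\bigcup_{m=1}^k\mathcal{M}_m(X)$ occurs. The upper Banach density of $S\subseteq\mathbb{N}$ is $d^*(S)=\limsup_{n}\max_k |S\cap\{k,\dots,k+n-1\}|/n$; $X$ is language stable if $\{n\colon\mathcal{M}_n(X)=\emptyset\}$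 has upper Banach density $1$. The shift $Z$: $\alpha\in(0,1)$ is irrational and $R_\alpha(x)=x+\alpha\pmod1$ on $[0,1)$. For $\beta\in(0,1)$, $X_\beta\subseteq\{0,1\}^{\mathbb{Z}}$ is the closure of the set of sequences $(x_j)_{j\in\mathbb{Z}}$, $x\in[0,1)$, with $x_j=0$ if $R_\alpha^jx\in[0,\beta)$ and $x_j=1$ otherwise. $(\beta_i)_{i\ge1}$ is a strictly increasing sequence in $\{n\alpha\pmod1\colon n\ge1\}$ with $\lim_i\beta_i=\alpha$, chosen so that $Z:=\overline{\bigcup_{i}X_{\beta_i}}$ is language stable. Put $Z_j:=X_{\beta_j}$ ($j\in\mathbb{N}$) and $Z_c:=X_\alpha$. The shift $X$: fix intervals $\{i_n,\dots,i_n+j_n\}$, with $(i_n)$ and $(j_n)$ strictly increasing, such that the $i_n$-th and $(i_n+j_n)$-th terms of the SFT cover of $Z$ coincide for all $n$. $X\subseteq\{0,1\}^{\mathbb{Z}}$ is a language stable, minimal subshift with $h_{\mathrm{top}}(X)>0$, such that the $i_n$-th and $(i_n+j_n)$-th terms of the SFT cover of $X$ coincide for infinitely many $n$, and such that $X\times Z_c$ and all $X\times Z_j$ ($j\in\mathbb{N}$) are minimal. *)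

(* Defs.v *)
From HB Require Import structures.
From mathcomp Require Import all_boot all_order all_algebra.
From mathcomp Require Import all_classical all_reals all_analysis.
Set Implicit Arguments.
Unset Strict Implicit.
Unset Printing Implicit Defensive.
Import Order.TTheory GRing.Theory Num.Theory.
Import numFieldNormedType.Exports.
Local Open Scope classical_set_scope.
Local Open Scope ring_scope.

Definition config (A : finType) : Type :=
  prod_topology (fun _ : int => discrete_topology A).

HB.instance Definition _ (A : finType) := Choice.on (config A).
HB.instance Definition _ (A : finType) := Nbhs.on (config A).
HB.instance Definition _ (A : finType) := Topological.on (config A).

Definition left_shift (A : finType) (x : config A) : config A := fun n => x (n + 1).

Definition right_shift (A : finType) (x : config A) : config A :=
  fun n => x (n - 1).

Record subshift (A : finType) := Subshift {
  carrier :> set (config A);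
  subshift_closed : closed carrier;
  subshift_nonempty : carrier !=set0;
  subshift_invariant : @left_shift A @` carrier = carrier }.

Definition minimal_subshift (A : finType) (X : subshift A) :=
  forall Y : subshift A, Y `<=` X -> Y = X :> set (config A).

Lemma config_coord_continuous (A : finType) (n : int) :
  continuous ((fun x => x n) : config A -> discrete_topology A).
Proof. exact: (@proj_continuous int (fun=> discrete_topology A) n). Qed.

Lemma config_continuous (T : topologicalType) (A : finType)
    (f : T -> config A) :
  (forall n, continuous ((fun x => f x n) : T -> discrete_topology A)) ->
  continuous f.
Proof.
move=> cf x; apply/cvg_sup => n U [V [[W oW <-] Wfn WU]].
apply: (@filterS _ (nbhs x) _ ((fun y => f y n) @^-1` W)).
  by move=> y /= Wy; apply: WU.
by apply: cf; exact: open_nbhs_nbhs.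
Qed.

Section Closure.
Variable A : finType.

Lemma left_shiftK : cancel (@left_shift A) (@right_shift A).
Proof. by move=> x; apply/funext => n; rewrite /left_shift /right_shift subrK. Qed.

Lemma right_shiftK : cancel (@right_shift A) (@left_shift A).
Proof. by move=> x; apply/funext => n; rewrite /left_shift /right_shift addrK. Qed.

Lemma left_shift_continuous : continuous (@left_shift A).
Proof. by apply: config_continuous => n; exact: config_coord_continuous. Qed.

Lemma right_shift_continuous : continuous (@right_shift A).
Proof. by apply: config_continuous => n; exact: config_coord_continuous. Qed.

Lemma left_shift_closure (S : set (config A)) :
  @left_shift A @` S = S -> @left_shift A @` closure S = closure S.
Proof.
move=> hS.
have sub (f : config A -> config A) : continuous f ->
    (forall x, S x -> S (f x)) -> forall x, closure S x -> closure S (f x).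
  move=> cf Sf x Sx U /(cf x) /Sx [y [Sy Uy]].
  by exists (f y); split => //; exact: Sf.
apply/seteqP; split => [_ [x Sx <-]|x Sx].
  apply: (sub _ left_shift_continuous) Sx => y Sy.
  by rewrite -hS; exists y.
exists (right_shift x); last exact: right_shiftK.
apply: (sub _ right_shift_continuous) Sx => y.
by rewrite -{1}hS => -[z Sz <-]; rewrite left_shiftK.
Qed.

Definition closure_subshift (S : set (config A)) (S0 : S !=set0)
    (Sinv : @left_shift A @` S = S) : subshift A :=
  Subshift (@closed_closure _ S) (subset_nonempty (@subset_closure _ S) S0)
    (left_shift_closure Sinv).

End Closure.

Section Product.
Variables A B : finType.

Definition config_fst (w : config (A * B)%type) : config A := fun n => (w n).1.
Definition config_snd (w : config (A * B)%type) : config B := fun n => (w n).2.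

Definition prod_set (X : set (config A)) (Y : set (config B)) :
  set (config (A * B)%type) := [set w | X (config_fst w) /\ Y (config_snd w)].

Lemma map_continuous (C D : finType) (f : C -> D) :
  continuous ((fun x n => f (x n)) : config C -> config D).
Proof.
apply: config_continuous => n x U Ufxn.
have /(_ (f @^-1` U)) := @config_coord_continuous C n x; apply.
apply: (@filterS _ (nbhs (x n : discrete_topology C)) _ [set x n]).
  by move=> _ /= ->; exact: nbhs_singleton Ufxn.
exact: discrete_set1.
Qed.

Lemma prod_closed (X : subshift A) (Y : subshift B) : closed (prod_set X Y).
Proof.
apply: closedI.
  apply: (@closed_comp _ _ config_fst _ _ (@subshift_closed _ X)).
  by move=> x _; exact: map_continuous.
apply: (@closed_comp _ _ config_snd _ _ (@subshift_closed _ Y)).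
by move=> x _; exact: map_continuous.
Qed.

Lemma prod_nonempty (X : subshift A) (Y : subshift B) :
  prod_set X Y !=set0.
Proof.
have [x Xx] := subshift_nonempty X; have [y Yy] := subshift_nonempty Y.
by exists (fun n => (x n, y n)).
Qed.

Lemma prod_invariant (X : subshift A) (Y : subshift B) :
  @left_shift _ @` prod_set X Y = prod_set X Y.
Proof.
apply/seteqP; split => [_ [w [Xw Yw] <-]|w [Xw Yw]].
  by split; rewrite -subshift_invariant;
    [exists (config_fst w)|exists (config_snd w)].
exists (right_shift w); last exact: right_shiftK.
split; move: Xw Yw; rewrite -{1}(subshift_invariant X).
  by move=> [x Xx xw] _; have <- : right_shift (left_shift x) = config_fst (right_shift w);
    [rewrite xw|rewrite left_shiftK].
rewrite -{1}(subshift_invariant Y).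
by move=> _ [x Xx xw]; have <- : right_shift (left_shift x) = config_snd (right_shift w);
  [rewrite xw|rewrite left_shiftK].
Qed.

Definition prod_subshift (X : subshift A) (Y : subshift B) :
    subshift (A * B)%type :=
  Subshift (@prod_closed X Y) (@prod_nonempty X Y) (@prod_invariant X Y).

End Product.

Lemma full2_nonempty : [set: config bool] !=set0.
Proof. by exists (fun=> false). Qed.

Lemma full2_invariant : @left_shift bool @` [set: config bool] = [set: config bool].
Proof.
by apply/seteqP; split => // x _; exists (right_shift x); rewrite ?right_shiftK.
Qed.

Definition full2 : subshift bool :=
  Subshift closedT full2_nonempty full2_invariant.

Section Words.
Variable A : finType.

Definition word_at (x : config A) (k : int) (n : nat) : seq A :=
  mkseq (fun m => x (k + m%:Z)) n.

Definition occurs_in (w : seq A) (x : config A) :=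
  exists k : int, word_at x k (size w) = w.

Definition language (X : set (config A)) : set (seq A) :=
  [set w | exists2 x, X x & occurs_in w x].

Definition minimal_forbidden (X : set (config A)) (n : nat) : set (seq A) :=
  [set w | [/\ size w = n, ~ language X w &
     forall u, infix u w -> u <> w -> language X u]].

Definition sft_cover (X : set (config A)) (k : nat) : set (config A) :=
  [set x | forall m w, (1 <= m <= k)%N -> minimal_forbidden X m w ->
     ~ occurs_in w x].

End Words.

Definition window_count (S : set nat) (k n : nat) : nat :=
  #|[pred i : 'I_n | `[< S (k + i)%N >]]|.

Definition upper_banach_density (R : realType) (S : set nat) : R :=
  limn_sup (fun n : nat =>
    sup (range (fun k : nat => (window_count S k n)%:R / n%:R : R))).

Definition language_stable (R : realType) (A : finType) (X : subshift A) :=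
  upper_banach_density R [set n | minimal_forbidden X n = set0] = 1.

Definition complexity (A : finType) (X : set (config A)) (n : nat) : nat :=
  #|[pred w : n.-tuple A | `[< language X w >]]|.

Definition htop (R : realType) (A : finType) (X : subshift A) : R :=
  limn (fun n : nat => ln ((complexity X n)%:R : R) / n%:R).

Section Entropy.
Context {d : measure_display} {T : measurableType d} {R : realType}.
Variable mu : probability T R.

(* A finite measurable partition is given by its labelling function
   xi : T -> I; its atoms are the fibres of xi (empty atoms contribute 0). *)
Definition finite_partition (I : finType) (xi : T -> I) :=
  forall a : I, measurable (xi @^-1` [set a]).

Definition partition_entropy (I : finType) (xi : T -> I) : R :=
  \sum_(a : I) - (fine (mu (xi @^-1` [set a])) *
                  ln (fine (mu (xi @^-1` [set a])))).

(* The labelling function of the join of the f^{-i} xi, 0 <= i < n. *)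
Definition itinerary (f : T -> T) (I : finType) (xi : T -> I) (n : nat) :
    T -> {ffun 'I_n -> I} :=
  fun x => [ffun i : 'I_n => xi (iter i f x)].

(* The limit exists, by subadditivity, as soon as f preserves mu. *)
Definition entropy_wrt (f : T -> T) (I : finType) (xi : T -> I) : R :=
  limn (fun n : nat => partition_entropy (itinerary f xi n) / n%:R).

Definition ks_entropy (f : T -> T) : \bar R :=
  ereal_sup [set h | exists (k : nat) (xi : T -> 'I_k),
    finite_partition xi /\ h = (entropy_wrt f xi)%:E].

End Entropy.

Section Space.
Variables (A : finType) (W : subshift A).

Definition points : Type := set_type W.

HB.instance Definition _ := Choice.on points.
HB.instance Definition _ := Nbhs.on points.
HB.instance Definition _ := Topological.on points.

Let points_point : points :=
  exist (fun x => x \in carrier W) _ (mem_set (projT2 (cid (subshift_nonempty W)))).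

HB.instance Definition _ := isPointed.Build points points_point.

Lemma shift_points_subproof (x : points) : left_shift (set_val x) \in carrier W.
Proof.
have Wx : (@left_shift A @` W) (left_shift (set_val x)).
  by exists (set_val x) => //; exact: set_valP.
by apply/mem_set; rewrite subshift_invariant in Wx.
Qed.

Definition shift_points (x : points) : points :=
  exist (fun y => y \in carrier W) (left_shift (set_val x)) (shift_points_subproof x).

Definition is_automorphism (psi : points -> points) :=
  [/\ continuous psi,
      (exists phi : points -> points,
        [/\ continuous phi, cancel psi phi & cancel phi psi]) &
      forall x, psi (shift_points x) = shift_points (psi x)].

Definition borel_space := g_sigma_algebraType (@open points).

HB.instance Definition _ := Measurable.on borel_space.

Variable R : realType.

Definition invariant_measure (mu : probability borel_space R)
    (psi : borel_space -> borel_space) :=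
  forall B : set borel_space, measurable B -> pushforward mu psi B = mu B.

Definition characteristic_measure (mu : probability borel_space R) :=
  forall psi : points -> points, is_automorphism psi -> invariant_measure mu psi.

Definition maximal_entropy (mu : probability borel_space R) :=
  invariant_measure mu shift_points /\ ks_entropy mu shift_points = (htop R W)%:E.

End Space.

Section Rotation.
Variable R : realType.
Implicit Types alpha beta x : R.

Definition mod1 x : R := x - (Num.floor x)%:~R.

Definition rotation alpha x : R := mod1 (x + alpha).

(* The j-th iterate of the bijection rotation alpha of [0, 1), for j in Z. *)
Definition rotation_iter alpha (j : int) x : R := mod1 (x + j%:~R * alpha).

Lemma mod1Dz x (m : int) : mod1 (x + m%:~R) = mod1 x.
Proof.
rewrite /mod1 floorDrz ?intr_int// intrKfloor intrD.
by rewrite opprD addrACA subrr addr0.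
Qed.

Lemma rotation_iter0 alpha x : 0 <= x < 1 -> rotation_iter alpha 0 x = x.
Proof.
move=> x01; rewrite /rotation_iter mul0r addr0 /mod1.
by rewrite (@floor_def _ x 0) ?subr0// add0r.
Qed.

Lemma rotation_iterS alpha (j : int) x :
  rotation_iter alpha (j + 1) x = rotation alpha (rotation_iter alpha j x).
Proof.
rewrite /rotation {2}/rotation_iter {2}/mod1 addrAC -mulrNz mod1Dz.
by rewrite /rotation_iter intrD mulrDl mul1r addrA.
Qed.

(* The symbols 0 and 1 are false and true. *)
Definition coding alpha beta x : config bool :=
  fun j => ~~ (0 <= rotation_iter alpha j x < beta).

Definition codings alpha beta : set (config bool) :=
  [set coding alpha beta x | x in [set x | 0 <= x < 1]].

Lemma codings_nonempty alpha beta : codings alpha beta !=set0.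
Proof. by exists (coding alpha beta 0), 0 => //=; rewrite lexx ltr01. Qed.

Lemma mod1_itv x : 0 <= mod1 x < 1.
Proof.
rewrite /mod1 subr_ge0 floor_le ltrBlDl.
by have := floorD1_gt x; rewrite intrD.
Qed.

Lemma codings_invariant alpha beta :
  @left_shift bool @` codings alpha beta = codings alpha beta.
Proof.
have E x (m : int) : coding alpha beta (mod1 (x + m%:~R * alpha)) =
    (fun n => coding alpha beta x (n + m)).
  apply/funext => n; rewrite /coding.
  suff -> : rotation_iter alpha n (mod1 (x + m%:~R * alpha)) =
            rotation_iter alpha (n + m) x by [].
  rewrite /rotation_iter {2}/mod1 addrAC -mulrNz mod1Dz; congr mod1.
  by rewrite intrD mulrDl -addrA; congr (_ + _); rewrite addrC.
apply/seteqP; split => [_ [_ [x _ <-] <-]|_ [x _ <-]].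
  exists (mod1 (x + 1%:~R * alpha)); first exact: mod1_itv.
  exact: E.
exists (coding alpha beta (mod1 (x + (-1)%:~R * alpha))).
  by exists (mod1 (x + (-1)%:~R * alpha)) => //; exact: mod1_itv.
by rewrite E; apply/funext => n; rewrite /left_shift addrK.
Qed.

Definition rotation_subshift alpha beta : subshift bool :=
  closure_subshift (codings_nonempty alpha beta) (codings_invariant alpha beta).

Lemma bigcup_nonempty alpha (beta : nat -> R) :
  \bigcup_i rotation_subshift alpha (beta i) !=set0.
Proof.
have [x hx] := subshift_nonempty (rotation_subshift alpha (beta 0%N)).
by exists x; exists 0%N.
Qed.

Lemma bigcup_invariant alpha (beta : nat -> R) :
  @left_shift bool @` (\bigcup_i rotation_subshift alpha (beta i)) =
  \bigcup_i rotation_subshift alpha (beta i).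
Proof.
rewrite image_bigcup; apply: eq_bigcupr => i _.
exact: (subshift_invariant (rotation_subshift alpha (beta i))).
Qed.

Definition union_subshift alpha (beta : nat -> R) : subshift bool :=
  closure_subshift (bigcup_nonempty alpha beta) (bigcup_invariant alpha beta).

End Rotation.

(* Main.v *)
Require Import Defs.
From HB Require Import structures.
From mathcomp Require Import all_boot all_order all_algebra.
From mathcomp Require Import all_classical all_reals all_analysis.
From mathcomp Require Import ring lra zify.
Import Order.TTheory GRing.Theory Num.Theory.
Import numFieldNormedType.Exports.
Local Open Scope ring_scope.
Set Implicit Arguments.
Unset Strict Implicit.
Unset Printing Implicit Defensive.

(* A product of subshifts has the product SFT cover, and the cover of the full
   shift is constant, so the cover (W_k) of W is constant on arbitrarily late
   and arbitrarily long blocks k, ..., k + l. A block map inducing an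
   automorphism of W maps W_(k+l) into W_k once l exceeds twice its radius, and
   it is invertible on W_k for k large; hence every automorphism permutes the
   p-periodic points of W_k, for all p, as soon as k and l are large.

   Counting paths in the graph of W_k by their last visits shows that W_k has
   at least e^(p (h_top(W) - eps)) periodic points of period p for infinitely
   many p. A limit, along an ultrafilter, of the equidistributed measures on
   such sets of periodic points is invariant under Aut(W); subadditivity of
   Shannon entropy passes the exponential growth rate to the limit, whose
   entropy is therefore at least h_top(W). The converse inequality holds for
   every invariant measure, by approximating Borel partitions with partitions
   into window sets. *)

(** * Shannon entropy of finite random variables *)

(** The factor [X] is minimal with positive entropy, so [W] has no periodic points and they must be
    sought in the covers. A periodic point of [W_k] is therefore replaced by a point of [W] that
    agrees with it near the origin, and the resulting measures are invariant only on sets that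
    depend on few coordinates. No stage need respect all of Aut(W); each automorphism is respected
    from some stage on, which is all that a limit sees. The entropy bound has to hold at a fixed
    word length [q] before the limit is taken: at period [p] the entropy rate of words of length [q]
    loses at most a term of order [q^2 / p], which vanishes as [p] grows with [q] fixed. The limit
    is taken set by set, on all subsets, and yields only a finitely additive content; compactness
    makes it countably additive on the sets determined by finitely many coordinates, and a
    Caratheodory extension gives the Borel measure. *)

Section ShannonEntropy.
Context {R : realType} {Om : finType}.
Variable P : Om -> R.
Hypothesis P_ge0 : forall w, 0 <= P w.

Definition law (I : finType) (g : Om -> I) (i : I) : R := \sum_(w | g w == i) P w.

Definition shannon (I : finType) (g : Om -> I) : R :=
  \sum_i - (law g i * ln (law g i)).

Lemma law_ge0 (I : finType) (g : Om -> I) i : 0 <= law g i.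
Proof. exact: sumr_ge0. Qed.

Lemma law_le (I J : finType) (g : Om -> I) (g' : Om -> J) i j :
  (forall w, g w = i -> g' w = j) -> law g i <= law g' j.
Proof.
move=> gg'; rewrite /law [leRHS](bigID (fun w => g w == i))/=.
rewrite (eq_bigl (fun w => (g' w == j) && (g w == i))).
  by rewrite lerDl sumr_ge0.
move=> w; case: eqP => [/gg' ->|]; first by rewrite eqxx.
by rewrite andbF.
Qed.

Lemma le_law (I : finType) (g : Om -> I) w : P w <= law g (g w).
Proof. by rewrite /law (bigD1 w)//= lerDl sumr_ge0. Qed.

Lemma sum_law (I : finType) (g : Om -> I) (F : I -> R) :
  \sum_i law g i * F i = \sum_w P w * F (g w).
Proof.
rewrite (partition_big g predT)//=; apply: eq_bigr => i _.
by rewrite /law mulr_suml; apply: eq_bigr => w /eqP ->.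
Qed.

Lemma shannonE (I : finType) (g : Om -> I) :
  shannon g = \sum_w - (P w * ln (law g (g w))).
Proof.
rewrite /shannon; under eq_bigr do rewrite -mulrN.
by rewrite (sum_law g (fun i => - ln (law g i))); apply: eq_bigr => w _; rewrite mulrN.
Qed.

(** When [g] determines [g'], the fibre of [g] through [w] lies in that of [g']; in the form
    [shannonE] the entropies then compare term by term. *)
Lemma shannon_le (I J : finType) (g : Om -> I) (g' : Om -> J) :
  (forall w w', g w = g w' -> g' w = g' w') -> shannon g' <= shannon g.
Proof.
move=> gg'; rewrite !shannonE; apply: ler_sum => w _; rewrite lerN2.
have := P_ge0 w; rewrite le0r => /orP[/eqP ->|Pw]; first by rewrite !mul0r.
rewrite ler_wpM2l// ler_ln ?posrE ?(lt_le_trans Pw (le_law _ _))//.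
by apply: law_le => w'; exact: gg'.
Qed.

Lemma eq_shannon (I J : finType) (g : Om -> I) (g' : Om -> J) :
  (forall w w', g w = g w' <-> g' w = g' w') -> shannon g = shannon g'.
Proof.
by move=> gg'; apply/eqP; rewrite eq_le !shannon_le// => w w' /gg'.
Qed.

Lemma ln_le_sub1 (x : R) : 0 < x -> ln x <= x - 1.
Proof. by move=> x0; have := @le_ln1Dx R (x - 1); rewrite [1 + _]addrC subrK; apply; lra. Qed.

(** Strong subadditivity: the conditional mutual information of [f] and [h] given [g] is
    nonnegative, because [ln x <= x - 1]. *)
Lemma shannon_submod (A B C : finType) (f : Om -> A) (g : Om -> B) (h : Om -> C) :
  shannon (fun w => (f w, g w, h w)) + shannon g <=
  shannon (fun w => (f w, g w)) + shannon (fun w => (g w, h w)).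
Proof.
set fg := fun w => (f w, g w); set gh := fun w => (g w, h w).
set fgh := fun w => (f w, g w, h w).
(* Density, against the joint law, of the law that makes [f] and [h] conditionally independent given
   [g]; its integral is at most the total mass. *)
pose q w := law fg (fg w) * law gh (gh w) / law g (g w) / law fgh (fgh w).
rewrite !shannonE -!big_split/= -subr_le0 -sumrB.
apply: (@le_trans _ _ (\sum_w P w * (q w - 1))).
  apply: ler_sum => w _; have := P_ge0 w.
  rewrite le0r => /orP[/eqP ->|Pw]; first by rewrite !mul0r !oppr0 !addr0.
  have pos (I : finType) (k : Om -> I) : 0 < law k (k w).
    exact: (lt_le_trans Pw (le_law _ _)).
  have -> : - (P w * ln (law fgh (fgh w))) - P w * ln (law g (g w)) -
      (- (P w * ln (law fg (fg w))) - P w * ln (law gh (gh w))) = P w * ln (q w).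
    rewrite /q !ln_div ?posrE ?divr_gt0 ?mulr_gt0//.
    rewrite lnM ?posrE//; ring.
  by apply: ler_wpM2l; [exact: ltW|apply: ln_le_sub1; rewrite /q !divr_gt0 ?mulr_gt0].
under eq_bigr do rewrite mulrBr mulr1.
rewrite sumrB subr_le0.
rewrite -(sum_law fgh (fun t => law fg t.1 * law gh (t.1.2, t.2) / law g t.1.2 / law fgh t)).
apply: (@le_trans _ _ (\sum_(t : A * B * C) law fg t.1 * law gh (t.1.2, t.2) / law g t.1.2)).
  apply: ler_sum => t _; rewrite mulrC.
  have [->|n0] := eqVneq (law fgh t) 0; last by rewrite divfK.
  by rewrite mulr0 divr_ge0 ?mulr_ge0 ?law_ge0.
rewrite -(pair_bigA _ (fun p c => law fg p * law gh (p.2, c) / law g p.2))/=.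
rewrite -(pair_bigA _ (fun a b => \sum_c law fg (a, b) * law gh (b, c) / law g b))/=.
rewrite exchange_big/=.
have marg1 b : \sum_a law fg (a, b) = law g b.
  rewrite /law [RHS](partition_big f predT)//=; apply: eq_bigr => a _.
  by apply: eq_bigl => w; rewrite /fg xpair_eqE andbC.
have marg2 b : \sum_c law gh (b, c) = law g b.
  rewrite /law [RHS](partition_big h predT)//=.
have -> : \sum_w P w = \sum_b law g b.
  by rewrite (partition_big g predT).
apply: ler_sum => b _.
under eq_bigr do rewrite -mulr_suml -mulr_sumr marg2.
rewrite -mulr_suml -mulr_suml marg1.
have [->|n0] := eqVneq (law g b) 0; first by rewrite invr0 !mulr0.
by rewrite mulfK.
Qed.

Hypothesis P1 : \sum_w P w = 1.

Lemma shannonD (A C : finType) (f : Om -> A) (h : Om -> C) :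
  shannon (fun w => (f w, h w)) <= shannon f + shannon h.
Proof.
have := shannon_submod f (fun=> tt) h.
rewrite (@eq_shannon _ _ _ (fun w => (f w, h w))); last first.
  by move=> w w'; split=> [[-> ->]|[-> ->]].
rewrite (@eq_shannon _ _ (fun w => (f w, tt)) f); last first.
  by move=> w w'; split=> [[->]|->].
rewrite (@eq_shannon _ _ (fun w => (tt, h w)) h); last first.
  by move=> w w'; split=> [[->]|->].
suff -> : shannon (fun=> tt) = 0 by rewrite addr0.
rewrite shannonE; under eq_bigr do rewrite -mulrN.
have -> : law (fun=> tt) tt = 1 by rewrite /law -P1; apply: eq_bigl => w.
by rewrite ln1 oppr0 -mulr_suml mulr0.
Qed.

(** Gibbs' inequality against the uniform law on [S]. Only values of positive probability have to
    lie in [S], so that later only words that really occur are counted. *)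
Lemma shannon_le_ln (I : finType) (g : Om -> I) (S : pred I) :
  (forall w, 0 < P w -> S (g w)) -> shannon g <= ln #|S|%:R.
Proof.
move=> gS.
have S0 : 0 < #|S|%:R :> R.
  rewrite ltr0n; apply/card_gt0P.
  have [w Pw] : exists w, 0 < P w.
    apply/not_existsP => P0; have := P1; rewrite big1 => [/eqP|w _].
      by rewrite eq_sym oner_eq0.
    by apply/eqP; rewrite eq_le P_ge0 leNgt andbT; apply/negP.
  by exists (g w); exact: gS.
have lawS i : i \notin S -> law g i = 0.
  move=> iS; rewrite /law big1// => w /eqP gwi.
  apply/eqP; rewrite eq_le P_ge0 leNgt andbT; apply/negP => /gS.
  by rewrite gwi -topredE/= in iS *; apply/negP.
rewrite -subr_le0.
have tot : \sum_(i in S) law g i = 1.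
  rewrite -P1 (partition_big g predT)//= [RHS](bigID (mem S))/=.
  by rewrite [X in _ + X]big1 ?addr0.
have -> : shannon g - ln #|S|%:R = \sum_(i in S) (law g i * ln (((law g i) * #|S|%:R)^-1)).
  rewrite /shannon (bigID (mem S))/= [X in _ + X - _]big1 ?addr0; last first.
    by move=> i /lawS ->; rewrite mul0r oppr0.
  have -> : ln (#|S|%:R : R) = \sum_(i in S) law g i * ln #|S|%:R.
    by rewrite -mulr_suml tot mul1r.
  rewrite -sumrB; apply: eq_bigr => i _.
  have [->|n0] := eqVneq (law g i) 0; first by rewrite !mul0r oppr0 addr0.
  have p0 : 0 < law g i by rewrite lt_neqAle eq_sym n0 law_ge0.
  have lS0 : 0 < law g i * #|S|%:R by rewrite mulr_gt0.
  by rewrite lnV ?posrE// lnM ?posrE//; ring.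
apply: (@le_trans _ _ (\sum_(i in S) (#|S|%:R^-1 - law g i))).
  apply: ler_sum => i _.
  have [->|n0] := eqVneq (law g i) 0; first by rewrite mul0r subr0 invr_ge0 ltW.
  have p0 : 0 < law g i by rewrite lt_neqAle eq_sym n0 law_ge0.
  apply: (le_trans (ler_wpM2l (ltW p0) (ln_le_sub1 _))).
    by rewrite invr_gt0 mulr_gt0.
  by rewrite mulrBr mulr1 invfM mulrA mulfV// mul1r.
by rewrite sumrB tot sumr_const -[_ *+ _]mulr_natr mulVf ?subrr// gt_eqF.
Qed.

End ShannonEntropy.

Section ConditionalEntropy.
Context {R : realType} {Om : finType}.
Variable P : Om -> R.
Hypothesis P_ge0 : forall w, 0 <= P w.

(* In terms of conditional entropies this reads
   [H(f, g | f', g') <= H(f | f') + H(g | g')]. *)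
Lemma shannon_cond (A B A' B' : finType) (f : Om -> A) (g : Om -> B)
    (a : A -> A') (b : B -> B') :
  shannon P (fun w => (f w, g w)) + shannon P (a \o f) + shannon P (b \o g) <=
  shannon P (fun w => (a (f w), b (g w))) + shannon P f + shannon P g.
Proof.
have h1 := shannon_submod P_ge0 f (a \o f) (b \o g).
have h2 := shannon_submod P_ge0 g (b \o g) f.
rewrite (@eq_shannon _ _ _ P_ge0 _ _ _ (fun w => (f w, b (g w)))) in h1; last first.
  by move=> w w' /=; split=> [[-> _ ->]|[-> ->]].
rewrite (@eq_shannon _ _ _ P_ge0 _ _ (fun w => (f w, (a \o f) w)) f) in h1; last first.
  by move=> w w' /=; split=> [[->]|->].
rewrite (@eq_shannon _ _ _ P_ge0 _ _ _ (fun w => (f w, g w))) in h2; last first.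
  by move=> w w' /=; split=> [[-> _ ->]|[-> ->]].
rewrite (@eq_shannon _ _ _ P_ge0 _ _ (fun w => (g w, (b \o g) w)) g) in h2; last first.
  by move=> w w' /=; split=> [[->]|->].
rewrite (@eq_shannon _ _ _ P_ge0 _ _ (fun w => ((b \o g) w, f w))
  (fun w => (f w, b (g w)))) in h2; last first.
  by move=> w w' /=; split=> [[-> ->]|[-> ->]].
have h3 : shannon P (fun w => ((a \o f) w, (b \o g) w)) =
  shannon P (fun w => (a (f w), b (g w))) by [].
rewrite h3 in h1; lra.
Qed.

End ConditionalEntropy.

(** * Counting paths and loops in a finite graph *)

Section PathCount.
Variable V : finType.

Definition count_words (n : nat) (Q : pred (seq V)) : nat :=
  #|[set s : n.-tuple V | Q s]|.

(** With the letter at position [q] fixed, a word is determined by what precedes and what follows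
    it. *)
Lemma count_words_split (q r : nat) (v : V) (Q Q1 Q2 : pred (seq V)) :
  (forall s, size s = (q + r.+1)%N -> Q s ->
    [/\ nth v s q = v, Q1 (take q s) & Q2 (drop q.+1 s)]) ->
  (count_words (q + r.+1) Q <= count_words q Q1 * count_words r Q2)%N.
Proof.
move=> QQ; rewrite /count_words -cardsX.
pose f (s : (q + r.+1).-tuple V) : q.-tuple V * r.-tuple V :=
  (insubd (nseq_tuple q v) (take q s), insubd (nseq_tuple r v) (drop q.+1 s)).
have f1 s : val (f s).1 = take q s.
  by rewrite val_insubd size_takel ?eqxx// size_tuple leq_addr.
have f2 s : val (f s).2 = drop q.+1 s.
  by rewrite val_insubd size_drop size_tuple ifT//; apply/eqP; lia.
rewrite -(@card_in_imset _ _ f).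
  apply/subset_leq_card/fintype.subsetP => _ /imsetP[s + ->]; rewrite !inE => /QQ.
  by rewrite size_tuple => /(_ erefl)[_ h1 h2]; move: h1 h2; rewrite -f1 -f2 => -> ->.
move=> s t; rewrite !inE => /QQ; rewrite size_tuple => /(_ erefl)[sv _ _].
move=> /QQ; rewrite size_tuple => /(_ erefl)[tv _ _] fst.
apply: val_inj => /=; rewrite -(cat_take_drop q s) -(cat_take_drop q t).
rewrite -!f1 fst; congr cat.
rewrite (drop_nth v) ?size_tuple; last by lia.
rewrite [in RHS](drop_nth v) ?size_tuple; last by lia.
by rewrite sv tv -!f2 fst.
Qed.

Variable e : rel V.

Definition path_count (S : {set V}) n :=
  count_words n (fun s => sorted e s && all (mem S) s).

Definition loop_count n := count_words n (cycle e).

(* Cut a path at the last visit to its first vertex: before the cut it is a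
   loop, after the cut it avoids that vertex. *)
Lemma path_count_le (S : {set V}) n :
  (path_count S n.+1 <=
   \sum_(q < n.+1) \sum_(v in S) loop_count q * path_count (S :\ v) (n - q))%N.
Proof.
pose Q (q : nat) v s := [&& sorted e s, all (mem S) s, head v s == v, nth v s q == v
  & v \notin drop q.+1 s].
apply: (@leq_trans (\sum_(q < n.+1) \sum_(v in S) count_words n.+1 (Q q v))).
  rewrite /path_count /count_words.
  have : [set s : n.+1.-tuple V | sorted e s & all (mem S) s] \subset
    \bigcup_(q < n.+1) \bigcup_(v in S) [set s : n.+1.-tuple V | Q q v s].
    apply/fintype.subsetP => -[[|v s'] ss]//; rewrite inE/=.
    move: (eqP ss); set s := v :: s' => sn /andP[es Ss].
    (* The last visit to [v] in [s] is the first one in [rev s]. *)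
    have lt_ir : (index v (rev s) < n.+1)%N.
      by rewrite -sn -size_rev index_mem mem_rev mem_head.
    have vs : (n.+1 - (index v (rev s)).+1 < n.+1)%N by lia.
    apply/finset.bigcupP; exists (Ordinal vs) => //.
    apply/finset.bigcupP; exists v; first by move: Ss => /andP[].
    rewrite inE /Q; apply/and5P; split => //.
      change (nth v s (n.+1 - (index v (rev s)).+1) == v).
      by rewrite -sn -nth_rev ?sn// nth_index// mem_rev mem_head.
    change (v \notin drop (n.+1 - (index v (rev s)).+1).+1 s).
    rewrite -subSn// subSS.
    rewrite -[s]revK drop_rev mem_rev size_rev revK sn subKn; last by lia.
    apply/negP => /(nthP v)[k]; rewrite size_takel ?size_rev ?sn; last by lia.
    move=> kl; rewrite nth_take// => kv.
    by have := before_find v kl; rewrite /= kv eqxx.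
  move=> /subset_leq_card /leq_trans; apply.
  elim/big_rec2 : _ => [|q B m _ le]; first by rewrite cards0.
  rewrite (leq_trans (leq_card_setU _ _).1)// leq_add//.
  elim/big_rec2 : _ => [|v B' m' _ le']; first by rewrite cards0.
  by rewrite (leq_trans (leq_card_setU _ _).1)// leq_add//.
apply: leq_sum => q _; apply: leq_sum => v vS.
have qn : n.+1 = (q + (n - q).+1)%N by have := ltn_ord q; lia.
rewrite {1}qn; apply: (@count_words_split _ _ v) => s ss /and5P[es Ss hs /eqP qs vs].
split => //.
  have {}ss : (q < size s)%N by lia.
  case: (nat_of_ord q) ss qs {vs} => [|k] ks kv; first by rewrite take0.
  case: s es Ss hs ks kv => //= u s es _ /eqP uv; rewrite ltnS => ks kv.
  rewrite uv in es *; rewrite rcons_path take_path//=.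
  have : path e v (take k.+1 s) by exact: take_path.
  by rewrite (take_nth v)// rcons_path kv => /andP[].
apply/andP; split; first exact: drop_sorted.
apply/allP => u us; rewrite /= !inE; apply/andP; split.
  by apply: contraNneq vs => <-.
by apply: (allP Ss); rewrite (mem_drop us).
Qed.

(** Paths grow no faster than loops, up to a polynomial factor. By induction on the number of
    allowed vertices: each cut of [path_count_le] removes a vertex and costs one factor linear in
    the length, from the choice of the cutting point. *)
Lemma path_count_bound (R : realType) (x C : R) : 0 < x -> 1 <= C ->
  (forall n, (0 < n)%N -> (loop_count n)%:R <= C * x ^+ n) ->
  exists2 K : R, 0 < K & forall n,
    (path_count finset.setT n)%:R <= (K * n.+1%:R) ^+ #|V| * x ^+ n.
Proof.
(* The loop and the remaining path have total length [n], one less than the original path; the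
   division by [x] supplies the missing factor. *)
move=> x0 C1 loopC; pose K := Num.max 1 (#|V|%:R * C / x).
have K1 : 1 <= K by rewrite /K le_max lexx.
have K0 : 0 < K by exact: lt_le_trans K1.
have VK : #|V|%:R * C <= K * x by rewrite -ler_pdivrMr// /K le_max lexx orbT.
exists K => // n.
suff : forall s (S : {set V}) n, (#|S| <= s)%N ->
    (path_count S n)%:R <= (K * n.+1%:R) ^+ s * x ^+ n.
  by apply; rewrite cardsT.
have Kn1 m : 1 <= K * m.+1%:R.
  by rewrite (le_trans K1)// ler_peMr ?ler1n// ltW.
elim => [|s IH] S {}n Ss.
  move: Ss; rewrite leqn0 cards_eq0 => /eqP ->; rewrite expr0 mul1r.
  case: n => [|n].
    by rewrite expr0 lern1 (leq_trans (max_card _))// card_tuple expn0.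
  rewrite /path_count /count_words (_ : [set _ | _] = finset.set0) ?cards0 ?exprn_ge0 ?ltW//.
  apply/finset.setP => -[[|u t] ht]; rewrite !inE//=.
  by rewrite inE andbF.
case: n => [|n].
  rewrite expr0 mulr1 (@le_trans _ _ 1) ?exprn_ege1//.
  by rewrite lern1 (leq_trans (max_card _))// card_tuple expn0.
have := path_count_le S n; rewrite -(ler_nat R) => /le_trans; apply.
rewrite natr_sum.
apply: (@le_trans _ _ (\sum_(q < n.+1) #|V|%:R * (C * x ^+ n * (K * n.+1%:R) ^+ s))).
  apply: ler_sum => q _; rewrite natr_sum.
  apply: (@le_trans _ _ (\sum_(v in S) (C * x ^+ n * (K * n.+1%:R) ^+ s))).
    apply: ler_sum => v vS; rewrite natrM.
    have qn : (q <= n)%N by rewrite -ltnS.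
    have -> : x ^+ n = x ^+ q * x ^+ (n - q) by rewrite -exprD subnKC.
    rewrite mulrA -[leRHS]mulrA ler_pM//.
      case: (nat_of_ord q) => [|k]; last exact: loopC.
      rewrite expr0 mulr1 (le_trans _ C1)//.
      by rewrite lern1 (leq_trans (max_card _))// card_tuple expn0.
    apply: (le_trans (IH _ _ _)).
      by move: Ss; rewrite (cardsD1 v) vS add1n ltnS.
    rewrite mulrC ler_wpM2l ?exprn_ge0 ?(ltW x0)//.
    rewrite lerXn2r ?nnegrE ?mulr_ge0 ?(ltW K0)//.
    by rewrite ler_wpM2l ?(ltW K0)// ler_nat ltnS leq_subr.
  rewrite sumr_const -[_ *+ _]mulr_natl ler_wpM2r ?ler_nat ?max_card//.
  by rewrite !mulr_ge0 ?exprn_ge0 ?mulr_ge0 ?(ltW x0) ?(ltW K0)// (le_trans _ C1).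
rewrite sumr_const card_ord -[_ *+ _]mulr_natl.
rewrite (_ : _ * _ = (#|V|%:R * C) * (n.+1%:R * (K * n.+1%:R) ^+ s * x ^+ n)); last by ring.
apply: (@le_trans _ _ ((K * x) * (n.+1%:R * (K * n.+1%:R) ^+ s * x ^+ n))).
  by rewrite ler_wpM2r// !mulr_ge0 ?exprn_ge0 ?mulr_ge0 ?(ltW x0) ?(ltW K0).
rewrite (_ : _ * _ = (K * n.+1%:R) ^+ s.+1 * x ^+ n.+1); last by rewrite !exprS; ring.
rewrite ler_wpM2r ?exprn_ge0 ?(ltW x0)//.
by rewrite lerXn2r ?nnegrE ?mulr_ge0 ?(ltW K0)// ler_wpM2l ?(ltW K0)// ler_nat.
Qed.

End PathCount.

Local Open Scope classical_set_scope.
Local Open Scope ring_scope.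

(** * Subadditive sequences *)

Section Fekete.
Variables (R : realType) (a : nat -> R).
Hypothesis a_ge0 : forall n, 0 <= a n.
Hypothesis aD : forall m n, a (m + n)%N <= a m + a n.

Lemma subadd_divn q n : a n <= (n %/ q)%:R * a q + a (n %% q)%N.
Proof.
rewrite {1}(divn_eq n q); move: (n %/ q)%N (n %% q)%N => k r.
elim: k => [|k IH]; first by rewrite mul0n mul0r !add0r.
rewrite mulSn -addnA (le_trans (aD _ _))// -natr1 mulrDl mul1r [leRHS]addrAC [leRHS]addrC.
by rewrite lerD2l.
Qed.

(** Fekete's argument with an explicit error. Besides giving the limit, it is applied at a single
    finite [n] to compare words of length [q] with a whole period. *)
Lemma subadd_ratio q n : (0 < q)%N -> (0 < n)%N ->
  a n / n%:R <= a q / q%:R + (\sum_(r < q) a r) / n%:R.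
Proof.
move=> q0 n0.
have n0R : 0 < n%:R :> R by rewrite ltr0n.
have q0R : 0 < q%:R :> R by rewrite ltr0n.
rewrite ler_pdivrMr// mulrDl divfK ?gt_eqF//.
apply: (le_trans (subadd_divn q n)); rewrite lerD//.
  rewrite [leRHS]mulrAC mulrC -mulrA ler_wpM2l// ler_pdivlMr//.
  by rewrite -natrM ler_nat leq_trunc_div.
rewrite (bigD1 (Ordinal (ltn_pmod n q0)))//= lerDl.
exact: sumr_ge0.
Qed.

Let E := [set a n / n%:R | n in [set n | (0 < n)%N]].

Lemma fekete_cvg : a n / n%:R @[n --> \oo] --> inf E.
Proof.
have E0 : E !=set0 by exists (a 1%N / 1%:R), 1%N.
have Eb : has_lbound E.
  by exists 0 => _ [n _ <-]; rewrite divr_ge0.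
apply/cvgrPdist_le => e e0.
have e20 : 0 < e / 2 by rewrite divr_gt0.
have [_ [q q0 <-] aq] := inf_adherent e20 (conj E0 Eb).
pose M := \sum_(r < q) a r.
have M0 : 0 <= M by exact: sumr_ge0.
near=> n.
have n0 : (0 < n)%N by near: n; exists 1%N.
have lo : inf E <= a n / n%:R by apply: ge_inf => //; exists n.
rewrite distrC ger0_norm ?subr_ge0// lerBlDl.
apply: (le_trans (subadd_ratio q0 n0)); rewrite -/M.
rewrite [e]splitr addrA lerD// ?(ltW aq)//.
rewrite ler_pdivrMr ?ltr0n// mulrC -ler_pdivrMr//.
by near: n; exact: nbhs_infty_ger.
Unshelve. all: by end_near. Qed.

Lemma fekete_le n : (0 < n)%N -> limn (fun n => a n / n%:R) <= a n / n%:R.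
Proof.
move=> n0; rewrite (cvg_lim _ fekete_cvg)//; apply: ge_inf; last by exists n.
by exists 0 => _ [m _ <-]; rewrite divr_ge0.
Qed.

Lemma fekete_ge l : (forall n, (0 < n)%N -> l <= a n / n%:R) ->
  l <= limn (fun n => a n / n%:R).
Proof.
move=> la; rewrite (cvg_lim _ fekete_cvg)//; apply: lb_le_inf.
  by exists (a 1%N / 1%:R), 1%N.
by move=> _ [n n0 <-]; exact: la.
Qed.

End Fekete.

(** * Words, windows and SFT covers *)

Section Windows.
Variable A : finType.
Implicit Types x y : config A.

Definition eqon (a : int) (m : nat) x y :=
  forall k : int, a <= k < a + m%:Z -> x k = y k.

Definition agree (r : nat) x y := forall k : int, (`|k| <= r)%N -> x k = y k.

Definition shiftz (m : int) x : config A := fun n => x (n + m).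

Lemma eqon_word a m x y : eqon a m x y <-> word_at x a m = word_at y a m.
Proof.
split=> [xy|xy k /andP[ak km]].
  rewrite /word_at /mkseq; apply/eq_in_map => k; rewrite mem_iota add0n => /andP[_ km].
  by apply: xy; lia.
have := congr1 (fun s => nth (x 0) s `|k - a|%N) xy.
rewrite /word_at !nth_mkseq; try lia.
by have -> : a + `|k - a|%N%:Z = k by lia.
Qed.

Lemma agree_le r s x y : (r <= s)%N -> agree s x y -> agree r x y.
Proof. by move=> rs xy k kr; apply: xy; exact: leq_trans rs. Qed.

Lemma nbhs_config x (U : set (config A)) :
  nbhs x U <-> exists r, forall y, agree r x y -> U y.
Proof.
split=> [|[r]].
  pose F : set_system (config A) := [set U | exists r, forall y, agree r x y -> U y].
  have FF : Filter F.
    split=> [|U1 U2 [r1 h1] [r2 h2]|U1 U2 U12 [r h]]; first by exists 0%N.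
      exists (maxn r1 r2) => y xy; split; [apply: h1|apply: h2].
        exact: agree_le (leq_maxl _ _) xy.
      exact: agree_le (leq_maxr _ _) xy.
    by exists r => y /h /U12.
  suff : F --> (x : config A) by apply.
  apply/cvg_sup => n V [B [[C oC <-] Cxn BV]].
  exists `|n|%N => y xy; apply: BV; rewrite /= -xy ?leqnn//.
move=> xU; suff : nbhs x (fun y => agree r x y) by apply: filterS.
have cn (n : int) : nbhs x (fun y : config A => x n = y n).
  apply: (@filterS _ (nbhs x) _ ((fun y : config A => y n) @^-1` [set x n])).
    by move=> y /= ->.
  apply: (@config_coord_continuous A n x); exact: discrete_set1.
clear xU; elim: r => [|r IH].
  by apply: filterS (cn 0) => y xy k; rewrite leqn0 absz_eq0 => /eqP ->.
apply: filterS3 IH (cn r.+1%:Z) (cn (- r.+1%:Z)) => y h1 h2 h3 k.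
rewrite leq_eqVlt ltnS => /orP[/eqP kr|]; last exact: h1.
by have [->|->] : k = r.+1%:Z \/ k = - r.+1%:Z by lia.
Qed.

Lemma compact_config : compact [set: config A].
Proof.
have := @tychonoff int (fun=> discrete_topology A) (fun=> [set: A]).
rewrite (_ : [set f | _] = [set: config A]); last exact/seteqP.
apply=> n; apply: finite_compact; exact: finite_finset.
Qed.

Variable W : subshift A.

Lemma shiftz_in m x : carrier W x -> carrier W (shiftz m x).
Proof.
have pos (n : nat) y : carrier W y -> carrier W (shiftz n%:Z y).
  move=> Wy; elim: n => [|n IH].
    by rewrite (_ : shiftz _ _ = y)//; apply/funext => k; rewrite /shiftz addr0.
  rewrite -subshift_invariant; exists (shiftz n%:Z y) => //.
  by apply/funext => k; rewrite /left_shift /shiftz; congr y; lia.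
case: m => [n|n]; first exact: pos.
rewrite NegzE; elim: n.+1 => [|k IH] Wx.
  by rewrite (_ : shiftz _ _ = x)//; apply/funext => k; rewrite /shiftz oppr0 addr0.
have := IH Wx; rewrite -{1}subshift_invariant => -[y Wy yx].
rewrite (_ : shiftz _ _ = y)//; apply/funext => j.
have := congr1 (fun z => z (j - 1)) yx; rewrite /left_shift /shiftz subrK => ->.
by congr x; lia.
Qed.

Lemma language_eqon x a m :
  language W (word_at x a m) <-> exists2 y, carrier W y & eqon a m y x.
Proof.
split=> [[y Wy [k]]|[y Wy yx]]; last first.
  by exists y => //; exists a; rewrite size_mkseq; apply/eqon_word.
rewrite size_mkseq => yx; exists (shiftz (k - a) y); first exact: shiftz_in.
apply/eqon_word; rewrite -yx; apply: eq_map => j; rewrite /shiftz; congr y; lia.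
Qed.

(** The SFT cover in terms of points of [W] instead of forbidden words: every window of length [k]
    is seen in some point of [W]. *)
Definition cover (W : set (config A)) (k : nat) : set (config A) :=
  [set x | forall a, exists2 y, W y & eqon a k y x].

Lemma cover_le k l : (k <= l)%N -> cover W l `<=` cover W k.
Proof.
move=> kl x Wx a; have [y Wy yx] := Wx a.
by exists y => // j ja; apply: yx; lia.
Qed.

(** A shortest window of [x] outside the language is a minimal forbidden word, since its proper
    subwords are shorter windows of [x]. *)
Lemma sft_coverE k : sft_cover W k = cover W k.
Proof.
apply/seteqP; split=> x xk.
  suff h m a : (m <= k)%N -> language W (word_at x a m).
    by move=> a; apply/language_eqon; exact: h.
  elim/ltn_ind: m a => m IH a mk; apply: contrapT => Lw.
  have m0 : (0 < m)%N.
    case: m Lw {IH mk} => // -[]; have [y Wy] := subshift_nonempty W.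
    by exists y => //; exists 0.
  apply: (xk m (word_at x a m)); rewrite ?m0//; last first.
    by exists a; rewrite size_mkseq.
  split; [by rewrite size_mkseq|by []|move=> u uw nuw].
  have szu : (size u < m)%N.
    have := size_infix uw; rewrite size_mkseq leq_eqVlt => /orP[/eqP su|//].
    by case/infixP: uw nuw => [[|? s] [[|? t] /[dup] e ->]];
      have := congr1 size e; rewrite ?cats0// !size_cat size_mkseq su/=; lia.
  case/infixP: uw => s [t e].
  suff -> : u = word_at x (a + (size s)%:Z) (size u).
    by apply: IH => //; apply: leq_trans mk; exact: ltnW.
  apply: (@eq_from_nth _ (x 0)); rewrite ?size_mkseq// => j ju.
  have := congr1 (fun v => nth (x 0) v (size s + j)%N) e.
  have /(congr1 size) := e; rewrite !size_cat size_mkseq => szm.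
  rewrite /word_at !nth_mkseq//; last by rewrite szm ltn_add2l ltn_addr.
  rewrite nth_cat ltnNge leq_addr/= addKn nth_cat ju => <-.
  by congr x; lia.
move=> m w /andP[m1 mk] [sw Lw _] [a aw]; apply: Lw; rewrite -aw sw.
exact/language_eqon/(cover_le mk xk).
Qed.

End Windows.

Lemma cover_prod (A B : finType) (X : subshift A) (Y : subshift B) k :
  cover (prod_subshift X Y) k = prod_set (cover X k) (cover Y k).
Proof.
apply/seteqP; split=> [w wk|w [w1 w2] a].
  by split=> a; have [y [Xy Yy] yw] := wk a;
    [exists (config_fst y)|exists (config_snd y)] => // j /yw;
    rewrite /config_fst /config_snd => ->.
have [x Xx xw] := w1 a; have [y Yy yw] := w2 a.
exists (fun n => (x n, y n)) => // j ja; rewrite xw// yw//.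
by rewrite /config_fst /config_snd; case: (w j).
Qed.

Lemma cover_full2 k : cover full2 k = [set: config bool].
Proof. by apply/seteqP; split=> // x _ a; exists x. Qed.

(** * Compactness, clopen sets and automorphisms of a subshift *)

Section Points.
Variables (A : finType) (W : subshift A).
Implicit Types x y : points W.

Local Notation "! x" := (set_val x : config A) (at level 2, format "! x").

Lemma point_of (z : config A) : carrier W z -> {x : points W | !x = z}.
Proof. by move=> Wz; exists (exist _ z (mem_set Wz)). Qed.

Lemma points_in x : carrier W !x. Proof. exact: set_valP. Qed.

Lemma val_points_inj x y : !x = !y -> x = y.
Proof. exact: val_inj. Qed.

Lemma nbhs_points x (U : set (points W)) :
  nbhs x U <-> exists r, forall y, agree r !x !y -> U y.
Proof.
split=> [|[r xU]].
  rewrite nbhsE => -[B [[C oC CB] Bx] BU].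
  have /nbhs_config[r rC] : nbhs (!x : config A) C.
    by apply: open_nbhs_nbhs; split=> //; move: Bx; rewrite -CB.
  by exists r => y /rC Cy; apply: BU; rewrite -CB.
have : nbhs (!x : config A) (fun z => agree r !x z).
  by apply/nbhs_config; exists r.
move=> /(@initial_continuous _ _ (set_val : points W -> config A)) h.
by apply: (@filterS _ (nbhs x) _ _ U _ h) => y; exact: xU.
Qed.

Lemma window_compact (P : points W -> nat -> Prop) :
  (forall x, exists r, P x r) ->
  exists N, forall y, exists x r, [/\ (r <= N)%N, agree r !x !y & P x r].
Proof.
move=> Px; apply: contrapT => /forallNP nP.
have {nP} /choice[f fP] : forall N, exists y : points W,
    ~ exists x r, [/\ (r <= N)%N, agree r !x !y & P x r].
  by move=> N; have := nP N; move/existsNP.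
pose F := (fun N => !(f N)) @ \oo.
have Wc : compact (carrier W).
  exact: (subclosed_compact (@subshift_closed _ W) (@compact_config A)).
have FW : F (carrier W) by exists 0%N => // N _; exact: points_in.
have PF : ProperFilter F by apply: fmap_proper_filter.
have [z [Wz Fz]] := Wc F PF FW.
have [x xz] := point_of Wz; have [r Pxr] := Px x.
have [_ [[N rN <-] zN]] : [set !(f N) | N in [set N | (r <= N)%N]] `&`
    (fun w => agree r z w) !=set0.
  apply: Fz; last by apply/nbhs_config; exists r.
  by exists r => // N rN; exists N.
by apply: (fP N); exists x, r; split; rewrite ?xz.
Qed.

Lemma window_uniform (T : Type) (f : points W -> T) :
  (forall x, exists r, forall y, agree r !x !y -> f y = f x) ->
  exists N, forall x y, agree N !x !y -> f x = f y.
Proof.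
move=> /window_compact[N fN]; exists N => x y xy.
have [z [r [rN zx zf]]] := fN x.
rewrite (zf x)// (zf y)// => k kr; rewrite zx// xy//.
exact: leq_trans rN.
Qed.

(** These are the clopen sets of [W]; they form an algebra that generates the Borel sets. *)
Definition window_set (C : set (points W)) :=
  exists r, forall x y, agree r !x !y -> C x -> C y.

Lemma agree_sym r (x y : config A) : agree r x y -> agree r y x.
Proof. by move=> xy k /xy. Qed.

Lemma window_setP C : window_set C <->
  exists r, forall x y, agree r !x !y -> C x <-> C y.
Proof.
split=> -[r Cr]; exists r => x y xy; last by move/(Cr _ _ xy).
by split; apply: Cr => //; exact: agree_sym.
Qed.

Lemma window_set0 : window_set set0. Proof. by exists 0%N. Qed.

Lemma window_setT : window_set setT. Proof. by exists 0%N. Qed.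

Lemma window_setC C : window_set C -> window_set (~` C).
Proof.
by case=> r Cr; exists r => x y /agree_sym xy nCx Cy; apply: nCx; exact: Cr Cy.
Qed.

Lemma window_setU C D : window_set C -> window_set D -> window_set (C `|` D).
Proof.
move=> [r Cr] [s Ds]; exists (maxn r s) => x y xy [Cx|Dx]; [left|right].
  by apply: Cr Cx; exact: agree_le (leq_maxl _ _) xy.
by apply: Ds Dx; exact: agree_le (leq_maxr _ _) xy.
Qed.

Lemma window_setI C D : window_set C -> window_set D -> window_set (C `&` D).
Proof.
move=> hC hD; rewrite -[C]setCK -[D]setCK -setCU.
by apply: window_setC; apply: window_setU; exact: window_setC.
Qed.

Lemma window_set_open C : window_set C -> open C.
Proof.
move=> [r Cr]; rewrite openE => x Cx; apply/nbhs_points.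
by exists r => y xy; exact: Cr Cx.
Qed.

Lemma open_window (U : set (points W)) : open U ->
  exists2 C : nat -> set (points W), (forall r, window_set (C r)) & U = \bigcup_r C r.
Proof.
rewrite openE => oU; exists (fun r => [set x | forall y, agree r !x !y -> U y]).
  move=> r; exists r => x y xy Cx z yz; apply: Cx => k kr.
  by rewrite xy// yz.
apply/seteqP; split=> [x /oU/nbhs_points[r rU]|x [r _]]; first by exists r.
exact.
Qed.

Lemma window_set_bigcup (C : set (points W)) (F : nat -> set (points W)) :
  window_set C -> (forall i, window_set (F i)) -> C `<=` \bigcup_i F i ->
  exists N, C `<=` \bigcup_(i < N) F i.
Proof.
(* The radius is at least [s], so that a centre close to a point of [C] is itself in [C], and at
   least the index [i], so that one bound controls both. *)
move=> [s Cs] Fw CF; pose P (x : points W) r :=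
  (s <= r)%N /\ (C x -> exists2 i, (i <= r)%N & forall y, agree r !x !y -> F i y).
have [N PN] : exists N, forall y, exists x r, [/\ (r <= N)%N, agree r !x !y & P x r].
  apply: window_compact => x; have [Cx|nCx] := pselect (C x); last by exists s.
  have [i _ Fix] := CF _ Cx; have [r Fr] := Fw i.
  exists (maxn s (maxn r i)); split=> [|_]; first exact: leq_maxl.
  exists i; first by rewrite !leq_max leqnn !orbT.
  move=> y xy; apply: Fr Fix; apply: agree_le xy.
  by rewrite !leq_max leqnn !orbT.
exists N.+1 => y Cy; have [x [r [rN xy [sr Px]]]] := PN y.
have [|i ir Fi] := Px.
  by apply: Cs Cy; apply: agree_sym; exact: agree_le xy.
exists i; last exact: Fi.
by rewrite /= ltnS (leq_trans ir).
Qed.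

Lemma val_shift_points x : !(shift_points x) = left_shift !x.
Proof. by []. Qed.

Lemma shift_pointsz m x : {y : points W | !y = shiftz m !x}.
Proof. by apply: point_of; apply: shiftz_in; exact: points_in. Qed.

Lemma automorphism_shiftz psi m x y : @is_automorphism A W psi ->
  !y = shiftz m !x -> !(psi y) = shiftz m !(psi x).
Proof.
move=> [_ _ psiS].
have pos (n : nat) u v : !v = shiftz n%:Z !u -> !(psi v) = shiftz n%:Z !(psi u).
  elim: n u v => [|n IH] u v uv.
    have -> : v = u by apply: val_points_inj; rewrite uv; apply/funext => k; rewrite /shiftz addr0.
    by apply/funext => k; rewrite /shiftz addr0.
  have [w wu] := shift_pointsz n%:Z u.
  have -> : v = shift_points w.
    apply: val_points_inj; rewrite uv; apply/funext => k.
    by rewrite val_shift_points /left_shift wu /shiftz; congr (!u _); lia.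
  rewrite psiS; apply/funext => k.
  by rewrite val_shift_points /left_shift (IH u w wu) /shiftz; congr (!(psi u) _); lia.
case: m => [n|n]; first exact: pos.
rewrite NegzE => yx.
have : !x = shiftz n.+1%:Z !y.
  by rewrite yx; apply/funext => k; rewrite /shiftz addrK.
move=> /pos ->; apply/funext => k; rewrite /shiftz; congr (!(psi y) _); lia.
Qed.

(** The Curtis-Hedlund-Lyndon theorem: coordinate 0 of [psi x] is locally constant, hence uniformly
    so, and commutation with the shift carries the radius to every coordinate. *)
Lemma automorphism_radius psi : @is_automorphism A W psi ->
  exists r, forall x y a, eqon (a - r%:Z) (r.*2.+1) !x !y -> !(psi x) a = !(psi y) a.
Proof.
move=> psiA; have [cpsi _ _] := psiA.
have [|r psir] := @window_uniform _ (fun x => !(psi x) 0).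
  move=> x; apply/nbhs_points.
  have : nbhs (psi x) [set y | !y 0 = !(psi x) 0].
    by apply/nbhs_points; exists 0%N => y ->.
  exact: cpsi.
exists r => x y a xy.
have [x' x'E] := shift_pointsz a x; have [y' y'E] := shift_pointsz a y.
have := automorphism_shiftz psiA x'E; have := automorphism_shiftz psiA y'E.
move=> /(congr1 (fun z => z 0)); rewrite /shiftz add0r => <-.
move=> /(congr1 (fun z => z 0)); rewrite /shiftz add0r => <-.
apply: psir => k kr; rewrite x'E y'E /shiftz; apply: xy; lia.
Qed.

Lemma automorphism_window_set psi C : @is_automorphism A W psi ->
  window_set C -> window_set (psi @^-1` C).
Proof.
move=> /automorphism_radius[r psir] [s Cs]; exists (r + s)%N => x y xy.
apply: Cs => k ks; apply: psir => j jr; apply: xy; lia.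
Qed.

Lemma automorphism_inv psi : @is_automorphism A W psi ->
  exists2 phi, @is_automorphism A W phi & cancel psi phi.
Proof.
move=> [cpsi [phi [cphi psiK phiK]] psiS]; exists phi => //; split=> //.
  by exists psi.
by move=> x; rewrite -{1}[x]phiK -psiS psiK.
Qed.

Lemma shift_automorphism : is_automorphism (@shift_points A W).
Proof.
have pre x : {y : points W | !y = right_shift !x}.
  apply: point_of; have -> : right_shift !x = shiftz (-1) !x by [].
  exact: shiftz_in (points_in x).
pose phi x := sval (pre x); have phiE x : !(phi x) = right_shift !x := svalP (pre x).
have cont (f : points W -> points W) :
    (forall x y r, agree r.+1 !x !y -> agree r !(f x) !(f y)) -> continuous f.
  move=> fr x U /nbhs_points[r rU]; apply/nbhs_points; exists r.+1 => y xy.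
  by apply: rU; exact: fr.
split=> //.
- apply: cont => x y r xy k kr.
  by rewrite !val_shift_points /left_shift; apply: xy; lia.
- exists phi; split.
  + by apply: cont => x y r xy k kr; rewrite !phiE; apply: xy; lia.
  + by move=> x; apply: val_points_inj; rewrite phiE val_shift_points left_shiftK.
  + by move=> x; apply: val_points_inj; rewrite val_shift_points phiE right_shiftK.
Qed.

End Points.

(** * Periodic points of SFT covers *)

Lemma sum_inj_set (R : realType) (T : finType) (S : {set T}) (f : T -> T) (G : T -> R) :
  {in S &, injective f} -> (forall c, c \in S -> f c \in S) ->
  \sum_(c in S) G (f c) = \sum_(c in S) G c.
Proof.
move=> finj fS; have fSE : (f @: S)%SET = S.
  apply/eqP; rewrite eqEcard card_in_imset// leqnn andbT.
  by apply/fintype.subsetP => _ /imsetP[c cS ->]; exact: fS.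
by rewrite -[in RHS]fSE big_imset.
Qed.

Section PeriodicPoints.
Variables (A : finType) (p : nat).

(** A periodic point is recorded by one period, which makes periodic points countable by cardinals
    of finite sets; the period is [p.+1] so that it is never 0. *)
Definition pext (c : {ffun 'I_p.+1 -> A}) : config A :=
  fun n => c (inord `|(n %% p.+1)%Z|).

Definition prestr (x : config A) : {ffun 'I_p.+1 -> A} := [ffun i : 'I_p.+1 => x i%:Z].

Lemma pextD c n : pext c (n + p.+1%:Z) = pext c n.
Proof. by rewrite /pext modzDr. Qed.

Lemma pextK : cancel pext prestr.
Proof.
move=> c; apply/ffunP => i; rewrite ffunE /pext; congr (c _); apply: val_inj => /=.
by rewrite modz_small ?ltz_nat ?ltn_ord//= inordK.
Qed.

Lemma prestrK (x : config A) : (forall n, x (n + p.+1%:Z) = x n) -> pext (prestr x) = x.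
Proof.
move=> xp; apply/funext => n; rewrite /pext ffunE inordK; last by lia.
have xpk (k : nat) m : x (m + k%:Z * p.+1%:Z) = x m.
  elim: k => [|k IH]; first by rewrite mul0r addr0.
  by rewrite -[k.+1]addn1 PoszD mulrDl mul1r addrA xp.
rewrite gez0_abs ?modz_ge0//; have := divz_eq n p.+1%:Z.
case: (n %/ p.+1)%Z => k {2}->; first by rewrite addrC xpk.
by rewrite -[RHS](xpk k.+1) NegzE mulNr addrAC addNr add0r.
Qed.

End PeriodicPoints.

(** * Automorphisms acting on the periodic points of the covers *)

Section BlockMaps.
Variables (A : finType) (W : subshift A).

Local Notation "! x" := (set_val x : config A) (at level 2, format "! x").

(* The values of [F] at windows outside the language of [W] are unconstrained, so
   [F] need not commute with the shift. *)
Definition block_map (r : nat) (psi : points W -> points W) (F : config A -> config A) :=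
  forall (y : points W) (x : config A) a,
    eqon (a - r%:Z) r.*2.+1 !y x -> F x a = !(psi y) a.

(** Every larger radius is admissible too, so an automorphism and its inverse can be given a common
    one. *)
Lemma automorphism_block_map psi : @is_automorphism A W psi ->
  exists r0, forall r, (r0 <= r)%N -> exists F, block_map r psi F.
Proof.
move=> /automorphism_radius[r0 psir]; exists r0 => r r0r.
pose near x a (y : points W) := eqon (a - r%:Z) r.*2.+1 !y x.
(* All points of [W] seen in the window give the same value; the default [x a] is used only at
   windows outside the language. *)
exists (fun x a => if pselect (exists y, near x a y) is left e
                   then !(psi (sval (cid e))) a else x a).
move=> y x a yx; case: pselect => [e|[]]; last by exists y.
case: (cid e) => z /= zx; apply: psir => k ka.
by rewrite zx ?yx//; lia.
Qed.

(** Here [p.+1] is a period, not necessarily the least one. *)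
Definition per (k p : nat) : {set {ffun 'I_p.+1 -> A}} :=
  [set c | `[< cover W k (pext c) >]]%SET.

Lemma perP k p (c : {ffun 'I_p.+1 -> A}) : reflect (cover W k (pext c)) (c \in per k p).
Proof. by rewrite finset.inE; exact: asboolP. Qed.

Variables (psi phi : points W -> points W) (r : nat) (F G : config A -> config A).
Hypotheses (psiA : @is_automorphism A W psi) (psiK : cancel psi phi).
Hypotheses (psiF : block_map r psi F) (phiG : block_map r phi G).

Lemma block_map_cover k x : cover W (k + r.*2) x -> cover W k (F x).
Proof.
move=> Wx a; have [y Wy yx] := Wx (a - r%:Z).
have [z zy] := point_of Wy; exists !(psi z); first exact: points_in.
move=> j ja; apply/esym/psiF => i ij; rewrite zy; apply: yx; lia.
Qed.

(** [F] itself may not commute with the shift, but [psi] does: a point of [W] seen in [x] around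
    [n + q] is, after a shift by [q], seen around [n]. *)
Lemma block_map_periodic (q : int) x : cover W r.*2.+1 x ->
  (forall n, x (n + q) = x n) -> forall n, F x (n + q) = F x n.
Proof.
move=> Wx xq n; have [y Wy yx] := Wx (n + q - r%:Z).
have [z zy] := point_of Wy; have [u uz] := shift_pointsz q z.
have zx : eqon (n + q - r%:Z) r.*2.+1 !z x by rewrite zy.
rewrite (psiF zx) (@psiF u).
  by rewrite (automorphism_shiftz psiA uz).
by move=> j jn; rewrite uz /shiftz zx ?xq//; lia.
Qed.

(** Windows of half-width [2r], of length [4r + 1], contain everything that the composition reads at
    one coordinate. *)
Lemma block_mapK x : cover W (r.*2.+1 + r.*2) x -> G (F x) = x.
Proof.
move=> Wx; apply/funext => n; have [y Wy yx] := Wx (n - r.*2%:Z).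
have [z zy] := point_of Wy; have zx : eqon (n - r.*2%:Z) (r.*2.+1 + r.*2) !z x by rewrite zy.
rewrite (@phiG (psi z)).
  by rewrite psiK zx//; lia.
by move=> j jn; apply/esym/psiF => i ij; apply: zx; lia.
Qed.

Variables (k p : nat).
Hypothesis k_ge : (r.*2.+1 + r.*2 <= k)%N.

Definition per_map (c : {ffun 'I_p.+1 -> A}) := prestr p (F (pext c)).

Lemma per_mapK c : c \in per k p -> pext (per_map c) = F (pext c).
Proof.
move=> /perP Wc; apply: prestrK; apply: block_map_periodic; last exact: pextD.
by apply: cover_le Wc; lia.
Qed.

Lemma per_map_inj : {in per k p &, injective per_map}.
Proof.
move=> c d cP dP /(congr1 (@pext _ _)); rewrite !per_mapK// => /(congr1 G).
rewrite !block_mapK.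
- by move=> /(can_inj (@pextK _ _)).
- by move/perP : dP; exact: cover_le.
- by move/perP : cP; exact: cover_le.
Qed.

Variable l : nat.
Hypotheses (l_ge : (r.*2 <= l)%N) (kl : cover W k = cover W (k + l)).

Lemma per_map_per c : c \in per k p -> per_map c \in per k p.
Proof.
move=> cP; apply/perP; rewrite per_mapK//; apply: block_map_cover.
by move/perP : cP; rewrite kl; apply: cover_le; lia.
Qed.

End BlockMaps.

(** * Word complexity and topological entropy *)

Section Complexity.
Variables (A : finType) (W : subshift A).

Lemma complexityE n :
  complexity W n = count_words n (fun w : seq A => `[< language W w >]).
Proof. by rewrite /count_words cardsE. Qed.

Lemma language_window w n : language W w -> size w = n ->
  exists2 x, carrier W x & word_at x 0 n = w.
Proof.
move=> [x Wx [a xa]] <-; exists (shiftz a x); first exact: shiftz_in.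
by rewrite -xa; rewrite size_mkseq; apply: eq_map => i; rewrite /shiftz; congr x; lia.
Qed.

Lemma language_word_at x a n : carrier W x -> language W (word_at x a n).
Proof. by move=> Wx; exists x => //; exists a; rewrite size_mkseq. Qed.

Lemma complexity_gt0 n : (0 < complexity W n)%N.
Proof.
have [x Wx] := subshift_nonempty W; apply/card_gt0P.
have sx : size (word_at x 0 n) == n by rewrite size_mkseq.
by exists (Tuple sx); apply/asboolP/(language_word_at 0 n Wx).
Qed.

Lemma complexityD m n : (complexity W (m + n) <= complexity W m * complexity W n)%N.
Proof.
have [x0 _] := subshift_nonempty W; have a0 : A := x0 0.
rewrite !complexityE /count_words -cardsX.
pose f (s : (m + n).-tuple A) : m.-tuple A * n.-tuple A :=
  (insubd (nseq_tuple m a0) (take m s), insubd (nseq_tuple n a0) (drop m s)).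
have f1 s : val (f s).1 = take m s.
  by rewrite val_insubd size_takel ?eqxx// size_tuple leq_addr.
have f2 s : val (f s).2 = drop m s.
  by rewrite val_insubd size_drop size_tuple addKn eqxx.
rewrite -(@card_in_imset _ _ f); last first.
  move=> s t _ _ fst; apply: val_inj => /=.
  by rewrite -(cat_take_drop m s) -(cat_take_drop m t) -!f1 -!f2 fst.
apply/subset_leq_card/fintype.subsetP => _ /imsetP[s + ->].
rewrite !finset.inE => /asboolP /language_window /(_ (size_tuple _)) [x Wx xs].
have -> : (f s).1 = word_at x 0 m :> seq A.
  rewrite f1 -xs; apply: (@eq_from_nth _ a0); rewrite size_takel ?size_mkseq ?leq_addr//.
  by move=> i im; rewrite nth_take// /word_at !nth_mkseq//; lia.
have -> : (f s).2 = word_at x m%:Z n :> seq A.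
  rewrite f2 -xs; apply: (@eq_from_nth _ a0); rewrite size_drop !size_mkseq ?addKn//.
  by move=> i im; rewrite nth_drop /word_at !nth_mkseq//; lia.
by apply/andP; split; apply/asboolP; exact: language_word_at.
Qed.

Variable R : realType.

Lemma ln_complexity_ge0 n : 0 <= ln (complexity W n)%:R :> R.
Proof. by rewrite ln_ge0// ler1n complexity_gt0. Qed.

Lemma ln_complexityD m n :
  ln (complexity W (m + n))%:R <= ln (complexity W m)%:R + ln (complexity W n)%:R :> R.
Proof.
rewrite -lnM ?posrE ?ltr0n ?complexity_gt0// -natrM.
by rewrite ler_ln ?posrE ?ltr0n ?muln_gt0 ?complexity_gt0// ler_nat complexityD.
Qed.

Lemma htop_ge0 : 0 <= htop R W.
Proof.
apply: fekete_ge => [||n n0]; [exact: ln_complexity_ge0|exact: ln_complexityD|].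
by rewrite divr_ge0// ln_complexity_ge0.
Qed.

(** By Fekete's lemma the entropy is an infimum, so the exponential lower bound holds at every
    length. *)
Lemma complexity_ge n : expR (htop R W * n%:R) <= (complexity W n)%:R.
Proof.
rewrite -[leRHS]lnK ?posrE ?ltr0n ?complexity_gt0// ler_expR.
case: n => [|n]; first by rewrite mulr0 ln_complexity_ge0.
rewrite -ler_pdivlMr ?ltr0n//.
by apply: fekete_le => //; [exact: ln_complexity_ge0|exact: ln_complexityD].
Qed.

Lemma htop_cvg : (ln (complexity W n)%:R / n%:R @[n --> \oo] --> htop R W)%classic.
Proof.
have := fekete_cvg ln_complexity_ge0 ln_complexityD.
by move=> h; rewrite /htop (cvg_lim _ h).
Qed.

End Complexity.

(** * Growth of the number of periodic points of a cover *)

Section CountPeriodic.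
Variables (A : finType) (W : subshift A) (k' : nat).
Let k := k'.+1.

(** The higher block graph that presents [W_k]: an edge requires both [k]-words to be in the
    language, but not the word of length [k + 1] that they form. *)
Definition overlap : rel (k.-tuple A) := fun u v =>
  [&& `[< language W u >], `[< language W v >] & drop 1 u == take k' v].

(** The successive [k]-windows of a word of length [n + k'] form a path on [n] vertices, which
    determines the word. *)
Lemma complexity_le_path n : (0 < n)%N ->
  (complexity W (n + k') <= path_count overlap finset.setT n)%N.
Proof.
move=> n0; have [x0 _] := subshift_nonempty W; have a0 : A := x0 0.
rewrite complexityE /path_count /count_words.
pose win (w : seq A) (i : nat) : k.-tuple A := [tuple nth a0 w (i + j) | j < k].
pose f (w : (n + k').-tuple A) : n.-tuple (k.-tuple A) := [tuple win w i | i < n].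
rewrite -(@card_in_imset _ _ f); last first.
  move=> s t _ _ fst; apply: (@eq_from_tnth _ _ s t) => i.
  rewrite !(tnth_nth a0).
  have [j [l [jn lk ->]]] : exists j l, [/\ (j < n)%N, (l < k)%N & val i = (j + l)%N].
    exists (minn i n.-1), (i - n.-1)%N; rewrite /k.
    by case: i => i /= il; split; lia.
  have := congr1 (fun u => tnth (tnth u (Ordinal jn)) (Ordinal lk)) fst.
  by rewrite !tnth_mktuple.
apply/subset_leq_card/fintype.subsetP => _ /imsetP[s + ->].
rewrite !finset.inE => /asboolP /language_window /(_ (size_tuple _)) [x Wx xs].
have winE i : (i < n)%N -> win s i = word_at x i%:Z k :> seq A.
  move=> lin; apply: (@eq_from_nth _ a0); rewrite size_tuple ?size_mkseq// => j jk.
  rewrite -[j]/(val (Ordinal jk)) -tnth_nth tnth_mktuple -xs /word_at !nth_mkseq//=.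
  by move: jk; rewrite /k; lia.
apply/andP; split; last by apply/allP => u _; rewrite /= finset.inE.
apply/(sortedP [tuple of nseq k a0]) => i; rewrite (size_tuple (f s)) => lin.
have nf j : (j < n)%N -> nth [tuple of nseq k a0] (f s) j = win s j.
  by move=> jn; rewrite -[j]/(val (Ordinal jn)) -tnth_nth tnth_mktuple.
rewrite !nf//; last exact: ltnW.
rewrite /overlap !winE//; last exact: ltnW.
apply/and3P; split; [apply/asboolP|apply/asboolP|]; try exact: language_word_at.
apply/eqP/(@eq_from_nth _ a0).
  by rewrite size_drop size_takel ?size_mkseq /k ?subn1.
rewrite size_drop size_mkseq subn1 => j jk.
have {}jk : (j < k')%N := jk; rewrite nth_drop nth_take// /word_at !nth_mkseq; try by rewrite /k; lia.
by congr x; lia.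
Qed.

(** The first letters along a loop spell one period of a point whose [k]-windows are the vertices of
    the loop. *)
Lemma loop_count_le p : (loop_count overlap p.+1 <= #|per W k p|)%N.
Proof.
have [x0 _] := subshift_nonempty W; have a0 : A := x0 0.
rewrite /loop_count /count_words.
pose f (s : p.+1.-tuple (k.-tuple A)) : {ffun 'I_p.+1 -> A} :=
  [ffun i => nth a0 (tnth s i) 0].
pose S (s : p.+1.-tuple (k.-tuple A)) (n : int) : k.-tuple A :=
  tnth s (inord `|(n %% p.+1)%Z|).
have fS s n : pext (f s) n = nth a0 (S s n) 0 by rewrite /pext ffunE.
have nxt (s : p.+1.-tuple _) n : cycle overlap s -> overlap (S s n) (S s (n + 1)).
  case: s => [[//|u s] hs] cs.
  have ss : size s = p by have := hs; rewrite /= eqSS => /eqP.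
  pose m := `|(n %% p.+1)%Z|%N.
  have mp : (m < p.+1)%N by rewrite /m; lia.
  have nm : (n %% p.+1)%Z = m by rewrite /m; lia.
  have := cs; rewrite [cycle _ _]/(path overlap u (rcons s u)).
  move=> /(pathP u) /(_ m); rewrite size_rcons ss => /(_ mp).
  rewrite /S !(tnth_nth u)/= inordK// nm/=.
  have -> : nth u (u :: rcons s u) m = nth u (u :: s) m.
    by rewrite -rcons_cons nth_rcons /= ss mp.
  suff -> : nth u (rcons s u) m = nth u (u :: s) (inord `|((n + 1) %% p.+1)%Z| : 'I_p.+1) by [].
  have [mp1|mp1] := ltnP m p.
    have -> : ((n + 1) %% p.+1)%Z = m.+1.
      by rewrite -modzDml nm modz_small//; lia.
    by rewrite inordK//= nth_rcons ss mp1.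
  have {}mp1 : m = p by lia.
  have -> : ((n + 1) %% p.+1)%Z = 0.
    by rewrite -modzDml nm mp1 -PoszD addn1 modzz.
  by rewrite inordK//= nth_rcons ss mp1 ltnn eqxx.
(* By the overlaps, letter [j] of a vertex is the first letter of the vertex [j] steps later. *)
have ext (s : p.+1.-tuple (k.-tuple A)) n j : cycle overlap s -> (j < k)%N -> nth a0 (S s n) j = pext (f s) (n + j%:Z).
  move=> cs; elim: j n => [|j IH] n jk; first by rewrite addr0 fS.
  have /and3P[_ _ /eqP e] := nxt s n cs.
  have -> : nth a0 (S s n) j.+1 = nth a0 (drop 1 (S s n)) j by rewrite nth_drop add1n.
  rewrite e nth_take ?IH//; last exact: ltnW.
  by congr (pext _ _); lia.
rewrite -(@card_in_imset _ _ f); last first.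
  move=> s t; rewrite !finset.inE => cs ct fst.
  apply: eq_from_tnth => i; apply: (@eq_from_tnth _ _ (tnth s i) (tnth t i)) => j.
  rewrite !(tnth_nth a0).
  have E (u : p.+1.-tuple _) : tnth u i = S u i%:Z.
    rewrite /S; congr tnth; apply: val_inj.
    by rewrite modz_small ?ltz_nat ?ltn_ord//= inordK.
  by rewrite !E !ext// fst.
apply/subset_leq_card/fintype.subsetP => _ /imsetP[s + ->].
rewrite finset.inE => cs; apply/perP => a; apply/language_eqon.
have /and3P[/asboolP + _ _] := nxt s a cs.
suff -> : S s a = word_at (pext (f s)) a k :> seq A by [].
apply: (@eq_from_nth _ a0); rewrite size_tuple ?size_mkseq// => j jk.
by rewrite ext// nth_mkseq.
Qed.

Variable R : realType.

(** If all late periods had fewer points, loops and hence paths would grow at rate at most [h], up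
    to a polynomial, whereas paths are at least as numerous as words of [W]. *)
Lemma per_count_ge (h : R) N : h < htop R W ->
  exists2 p, (N <= p)%N & expR (h * p.+1%:R) <= #|per W k p|%:R.
Proof.
move=> hh; apply: contrapT => nP.
have {nP} lt_per p : (N <= p)%N -> #|per W k p|%:R < expR h ^+ p.+1.
  move=> Np; rewrite -expRM_natr ltNge; apply/negP => le; apply: nP.
  by exists p.
have x0 : 0 < expR h by exact: expR_gt0.
(* Absorbs the finitely many periods below [N], for which no bound is assumed. *)
pose C := 1 + \sum_(p < N) #|per W k p|%:R / expR h ^+ p.+1.
have t0 p : 0 <= #|per W k p|%:R / expR h ^+ p.+1.
  by rewrite divr_ge0// exprn_ge0// ltW.
have C1 : 1 <= C by rewrite lerDl sumr_ge0.
have [//|K K0 PK] := @path_count_bound _ overlap R (expR h) C x0 C1.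
  case=> // p _; apply: (@le_trans _ _ #|per W k p|%:R); first by rewrite ler_nat loop_count_le.
  have [pN|Np] := ltnP p N.
    rewrite -ler_pdivrMr ?exprn_gt0// /C (bigD1 (Ordinal pN))//= addrCA lerDl.
    by rewrite addr_ge0// sumr_ge0.
  by rewrite (le_trans (ltW (lt_per _ Np)))// ler_peMl ?exprn_ge0 ?(ltW x0).
set d := #|{: k.-tuple A}| in PK.
(* The gap is divided by [d.+1] because [c * n <= expR (c * n)], raised to the power [d.+1], yields
   a polynomial of degree [d.+1], which outgrows the degree [d] of [path_count_bound]. *)
pose c := (htop R W - h) / d.+1%:R.
have c0 : 0 < c by rewrite divr_gt0 ?subr_gt0 ?ltr0n.
have bound n : (0 < n)%N -> c ^+ d.+1 * n%:R <= (K *+ 2) ^+ d.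
  move=> n0; have nR : 0 < n%:R :> R by rewrite ltr0n.
  rewrite -(@ler_pM2r _ (n%:R ^+ d)) ?exprn_gt0// -mulrA -exprS -!exprMn.
  apply: (@le_trans _ _ ((K * n.+1%:R) ^+ d)); last first.
    rewrite lerXn2r ?nnegrE ?mulr_ge0 ?mulrn_wge0 ?(ltW K0)//.
    rewrite mulrnAl -mulrnAr ler_wpM2l ?(ltW K0)// -mulrnA ler_nat; lia.
  apply: (@le_trans _ _ (expR (c * n%:R) ^+ d.+1)).
    have cn0 : 0 <= c * n%:R by rewrite mulr_ge0 // ltW.
    have le_exp : c * n%:R <= expR (c * n%:R).
      by apply: le_trans (expR_ge1Dx _); rewrite lerDr.
    by rewrite lerXn2r ?nnegrE// expR_ge0.
  rewrite -expRM_natr mulrAC /c divfK ?pnatr_eq0//.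
  rewrite -(@ler_pM2r _ (expR h ^+ n)) ?exprn_gt0//.
  apply: le_trans (PK n); rewrite -expRM_natr -expRD -mulrDl subrK.
  apply: (le_trans _ (_ : (complexity W (n + k'))%:R <= _)); last first.
    by rewrite ler_nat complexity_le_path.
  apply: le_trans (complexity_ge W R _); rewrite ler_expR ler_wpM2l ?htop_ge0//.
  by rewrite ler_nat leq_addr.
pose B := (K *+ 2) ^+ d / c ^+ d.+1.
have B0 : 0 <= B by rewrite divr_ge0 ?exprn_ge0 ?mulrn_wge0 ?(ltW K0) ?(ltW c0).
have := bound (Num.bound B).+1 isT.
rewrite mulrC -ler_pdivlMr ?exprn_gt0// leNgt -/B => /negP; apply.
by rewrite (lt_le_trans (archi_boundP B0))// ler_nat.
Qed.

End CountPeriodic.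

(** * The measures equidistributed on periodic points *)

Section Stage.
Variables (R : realType) (A : finType) (W : subshift A).

Local Notation "! x" := (set_val x : config A) (at level 2, format "! x").

Definition cylinder q (w : {ffun 'I_q -> A}) : set (points W) :=
  [set x : points W | forall i : 'I_q, !x i%:Z = w i].

Lemma window_cylinder q (w : {ffun 'I_q -> A}) : window_set (cylinder w).
Proof.
exists q => x y xy xw i; rewrite -xy ?xw//; have := ltn_ord i; lia.
Qed.

Variables (k p n : nat).
Hypothesis nk : (n.*2.+1 <= k)%N.

(** Periodic points of [W_k] may lie outside [W]; since [k >= 2n + 1], a point of [W] agrees with
    each of them on [[-n, n]]. *)
Lemma sample_exists : exists s : {ffun 'I_p.+1 -> A} -> points W,
  forall c, c \in per W k p -> agree n (pext c) !(s c).
Proof.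
have /choice[s sP] : forall c : {ffun 'I_p.+1 -> A}, exists x : points W,
    c \in per W k p -> agree n (pext c) !x.
  move=> c; have [/perP Wc|nc] := boolP (c \in per W k p).
    have [y Wy yc] := Wc (- n%:Z); have [x xy] := point_of Wy.
    by exists x => _ j jn; rewrite xy yc//; lia.
  by have [y Wy] := subshift_nonempty W; have [x _] := point_of Wy; exists x.
by exists s.
Qed.

Hypothesis per0 : (0 < #|per W k p|)%N.
Variable s : {ffun 'I_p.+1 -> A} -> points W.
Hypothesis sP : forall c, c \in per W k p -> agree n (pext c) !(s c).

(** Defined on every subset, so that the limit can be taken set by set. *)
Definition empirical (C : set (points W)) : R :=
  \sum_(c in per W k p) (`[< C (s c) >]%:R / #|per W k p|%:R).

Let N0 : 0 < #|per W k p|%:R :> R. Proof. by rewrite ltr0n. Qed.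

Lemma empirical_ge0 C : 0 <= empirical C.
Proof. by apply: sumr_ge0 => c _; rewrite divr_ge0. Qed.

Lemma empiricalT : empirical setT = 1.
Proof.
rewrite /empirical (eq_bigr (fun=> #|per W k p|%:R^-1)).
  by rewrite sumr_const -[_ *+ _]mulr_natr mulVf// gt_eqF.
by move=> c _; rewrite asboolT// mul1r.
Qed.

Lemma empiricalU C D : C `&` D = set0 ->
  empirical (C `|` D) = empirical C + empirical D.
Proof.
move=> CD; rewrite /empirical -big_split; apply: eq_bigr => c _ /=.
rewrite -mulrDl; congr (_ / _); rewrite asbool_or.
have : ~ (C (s c) /\ D (s c)) by rewrite -[_ /\ _]/((C `&` D) _) CD.
by case: asboolP => // Cc; case: asboolP => //= Dc; rewrite ?addr0 ?add0r// => /(_ (conj Cc Dc)).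
Qed.

(** On [[-t, t]], the image under [psi] of the sample of [c] agrees with [F (pext c)], hence with
    the sample of the periodic point [per_map F c]. As [C] reads only these coordinates, the two
    sums differ by a permutation of the periodic points. *)
Lemma empirical_invariant l psi phi r F G t C :
  @is_automorphism A W psi -> cancel psi phi -> block_map r psi F -> block_map r phi G ->
  (r.*2.+1 + r.*2 <= k)%N -> (r.*2 <= l)%N -> cover W k = cover W (k + l) ->
  (forall x y : points W, agree t !x !y -> C x <-> C y) -> (t + r <= n)%N ->
  empirical (psi @^-1` C) = empirical C.
Proof.
move=> psiA psiK psiF phiG rk rl kl tC trn.
pose f := per_map F (p := p).
have fE c : c \in per W k p -> pext (f c) = F (pext c).
  by move=> cP; rewrite (per_mapK psiA psiF rk).
have fP c : c \in per W k p -> f c \in per W k p.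
  by move=> cP; apply: (per_map_per psiA psiF rk rl kl).
rewrite /empirical -[RHS](@sum_inj_set _ _ _ f); last 2 first.
- exact: (per_map_inj psiA psiK psiF phiG rk).
- exact: fP.
apply: eq_bigr => c cP; congr (_%:R / _); congr nat_of_bool.
apply: asbool_equiv_eq; apply: tC => j jt.
rewrite -(sP (fP _ cP)) ?fE//; last by lia.
apply/esym/psiF => i ij; apply/esym/(sP cP); lia.
Qed.

(** The uniform law on the periodic points themselves rather than on their samples: unlike
    [empirical], it is exactly shift invariant. *)
Definition pmf (c : {ffun 'I_p.+1 -> A}) : R := (c \in per W k p)%:R / #|per W k p|%:R.

Lemma pmf_ge0 c : 0 <= pmf c. Proof. by rewrite divr_ge0. Qed.

Lemma pmf_sum (G : {ffun 'I_p.+1 -> A} -> R) :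
  \sum_c pmf c * G c = \sum_(c in per W k p) #|per W k p|%:R^-1 * G c.
Proof.
rewrite [RHS]big_mkcond; apply: eq_bigr => c _; rewrite /pmf.
by case: ifP => _; rewrite ?mul1r// !mul0r.
Qed.

Lemma pmf1 : \sum_c pmf c = 1.
Proof.
under eq_bigr do rewrite -[pmf _]mulr1.
by rewrite pmf_sum sumr_const mulr1 -[_ *+ _]mulr_natr mulVf// gt_eqF.
Qed.

Definition pword q (c : {ffun 'I_p.+1 -> A}) : {ffun 'I_q -> A} :=
  [ffun i : 'I_q => pext c i%:Z].

Lemma empirical_cylinder q (w : {ffun 'I_q -> A}) : (q <= n.+1)%N ->
  empirical (cylinder w) = law pmf (pword q) w.
Proof.
move=> qn; have -> : law pmf (pword q) w = \sum_c pmf c * (pword q c == w)%:R.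
  rewrite /law big_mkcond; apply: eq_bigr => c _.
  by case: eqP; rewrite ?mulr1 ?mulr0.
rewrite pmf_sum; apply: eq_bigr => c cP; rewrite mulrC; congr (_ * _%:R).
congr nat_of_bool; apply/asboolP/eqP => [sw|<- i].
  apply/ffunP => i; rewrite ffunE -sw (sP cP)//.
  have := ltn_ord i; lia.
by rewrite ffunE (sP cP)//; have := ltn_ord i; lia.
Qed.

Let a q := shannon pmf (pword q).

(** The shift by [q1] permutes the periodic points, so the word at positions [q1, ..., q1 + q2 - 1]
    has the same entropy as the word of length [q2] at 0. *)
Lemma shannon_pwordD q1 q2 : a (q1 + q2)%N <= a q1 + a q2.
Proof.
pose f (c : {ffun 'I_p.+1 -> A}) := prestr p (shiftz q1%:Z (pext c)).
have fE c : pext (f c) = shiftz q1%:Z (pext c).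
  by apply: prestrK => j; rewrite /shiftz addrAC pextD.
have -> : a q2 = shannon pmf (pword q2 \o f).
  rewrite /a /shannon; apply: eq_bigr => w _.
  suff -> : law pmf (pword q2) w = law pmf (pword q2 \o f) w by [].
  have L g : law pmf g w = \sum_c pmf c * (g c == w)%:R.
    rewrite /law big_mkcond; apply: eq_bigr => c _.
    by case: eqP; rewrite ?mulr1 ?mulr0.
  rewrite !L !pmf_sum -[LHS](@sum_inj_set _ _ _ f)//.
    move=> c d _ _ /(congr1 (@pext _ _)); rewrite !fE => cd.
    apply: (can_inj (@pextK _ _)); apply/funext => j.
    by have := congr1 (fun x => x (j - q1%:Z)) cd; rewrite /shiftz subrK.
  move=> c /perP Wc; apply/perP; rewrite fE => j.
  have [y Wy yc] := Wc (j + q1%:Z); exists (shiftz q1%:Z y).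
    exact: shiftz_in.
  by move=> i ij; apply: yc; lia.
apply: le_trans (shannonD pmf_ge0 pmf1 _ _).
apply: (shannon_le pmf_ge0) => c d [cd1 cd2]; apply/ffunP => i; rewrite !ffunE.
have [iq|iq] := ltnP i q1.
  by have /ffunP/(_ (Ordinal iq)) := cd1; rewrite !ffunE.
have iq2 : (i - q1 < q2)%N by have := ltn_ord i; lia.
have /ffunP/(_ (Ordinal iq2)) := cd2; rewrite !ffunE !fE /shiftz/=.
by rewrite -PoszD subnK.
Qed.

Lemma shannon_pword_per : a p.+1 = ln #|per W k p|%:R.
Proof.
rewrite /a shannonE; under eq_bigr do rewrite -mulrN.
rewrite pmf_sum (eq_bigr (fun=> #|per W k p|%:R^-1 * ln #|per W k p|%:R)).
  by rewrite sumr_const -mulrnAl -[_ *+ _]mulr_natr mulVf ?mul1r// gt_eqF.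
move=> c cP; congr (_ * _); suff -> : law pmf (pword p.+1) (pword p.+1 c) = #|per W k p|%:R^-1.
  by rewrite lnV ?posrE// opprK.
rewrite /law (big_pred1 c) => [|d]; first by rewrite /pmf cP mul1r.
apply/eqP/eqP => [cd|->//]; rewrite -[c]pextK -[d]pextK; apply/ffunP => i.
by have /ffunP/(_ i) := cd; rewrite !ffunE.
Qed.

(** [subadd_ratio] at the full period, whose word determines the periodic point. Each of the [q]
    remainder entropies is at most [q * ln #|A|], whence the square. *)
Lemma shannon_pword_ge h q : (n <= p)%N -> (0 < q)%N -> 0 <= h ->
  expR (h * p.+1%:R) <= #|per W k p|%:R ->
  h - (q%:R ^+ 2 * ln #|A|%:R) / n.+1%:R <= a q / q%:R.
Proof.
move=> np q0 h0 hper.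
have a0 q' : 0 <= a q'.
  rewrite /a /shannon; apply: sumr_ge0 => w _; rewrite -mulrN.
  have lw1 : law pmf (pword q') w <= 1.
    by rewrite -pmf1 [leRHS](bigID (fun c => pword q' c == w))/= lerDl sumr_ge0// => *; exact: pmf_ge0.
  by rewrite mulr_ge0 ?(law_ge0 pmf_ge0)// oppr_ge0 ln_le0.
have A0 : (0 < #|A|)%N.
  by have [x _] := subshift_nonempty W; apply/card_gt0P; exists (x 0).
have lnA : 0 <= ln #|A|%:R :> R by rewrite ln_ge0// ler1n.
have ale q' : a q' <= q'%:R * ln #|A|%:R.
  apply: (le_trans (shannon_le_ln pmf_ge0 pmf1 (S := predT) _)) => //.
  rewrite card_ffun card_ord; case: q' => [|q']; first by rewrite expn0 ln1 mul0r.
  by rewrite natrX lnXn ?ltr0n// mulr_natl.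
have p0 : 0 < p.+1%:R :> R by rewrite ltr0n.
have hp : h <= a p.+1 / p.+1%:R.
  by rewrite ler_pdivlMr// shannon_pword_per -ler_expR lnK// posrE.
have := subadd_ratio a0 shannon_pwordD q0 (ltn0Sn p).
rewrite lerBlDr => /(le_trans hp) /le_trans; apply; rewrite lerD2l.
apply: (@le_trans _ _ (q%:R ^+ 2 * ln #|A|%:R / p.+1%:R)); last first.
  rewrite ler_wpM2l ?mulr_ge0 ?exprn_ge0//.
  by rewrite lef_pV2 ?posrE ?ltr0n// ler_nat.
rewrite ler_wpM2r ?invr_ge0 ?(ltW p0)//.
apply: (@le_trans _ _ (\sum_(r < q) q%:R * ln #|A|%:R)).
  apply: ler_sum => r _; apply: (le_trans (ale _)).
  by rewrite ler_wpM2r// ler_nat ltnW.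
by rewrite sumr_const card_ord -[_ *+ _]mulr_natl mulrA expr2.
Qed.

End Stage.

(** * Limits along ultrafilters and continuity of the entropy function *)

Lemma fmap_ultra (T U : Type) (f : T -> U) (F : set_system T) :
  UltraFilter F -> UltraFilter (f @ F).
Proof.
move=> UF; split; first exact: fmap_proper_filter.
move=> G GF FG; apply/seteqP; split => // B GB.
have [//|FB] := in_ultra_setVsetC (f @^-1` B) UF.
have /FG GnB : (f @ F) (~` B) by [].
have := filterI GB GnB; rewrite setICr => G0.
by case: (@filter_not_empty _ G _ (G0 _)).
Qed.

Lemma ultra_cvg (R : realType) (T : Type) (F : set_system T) (u : T -> R) :
  UltraFilter F -> (forall t, 0 <= u t <= 1) -> exists l : R, u @ F --> l.
Proof.
move=> UF u01; have uF := fmap_ultra u UF.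
have := @segment_compact R 0 1; rewrite compact_ultra => /(_ (u @ F) uF).
case; last by move=> l [_ ul]; exists l.
by apply: (@filterE _ F) => t; rewrite /= in_itv/= u01.
Qed.

Section EntropyFunction.
Variable R : realType.

(** With [s = sqrt t], the left side is [2 s * (s * ln (1 / s))] and [ln (1 / s) <= 1 / s]. This
    modulus at 0 serves both the limit of entropies and the Fano-type estimate. *)
Lemma neg_xlnx_le (t : R) : 0 <= t -> - (t * ln t) <= 2 * Num.sqrt t.
Proof.
rewrite le0r => /orP[/eqP ->|t0]; first by rewrite mul0r oppr0 mulr_ge0// sqrtr_ge0.
have s0 : 0 < Num.sqrt t by rewrite sqrtr_gt0.
rewrite -{1 2}(sqr_sqrtr (ltW t0)); set s := Num.sqrt t in s0 *.
rewrite lnXn//.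
have -> : - (s ^+ 2 * (ln s *+ 2)) = 2 * (s * (s * - ln s)) by ring.
rewrite ler_pM2l// -lnV ?posrE//; apply: (@le_trans _ _ (s * (s * s^-1))).
  rewrite !ler_wpM2l ?(ltW s0)//; apply: (le_trans (ln_le_sub1 _)); first by rewrite invr_gt0.
  by rewrite gerDl lerN10.
by rewrite mulfV ?gt_eqF// mulr1.
Qed.

Lemma cvg_xlnx (T : Type) (F : set_system T) (u : T -> R) (l : R) : Filter F ->
  (forall t, 0 <= u t <= 1) -> 0 <= l -> u @ F --> l ->
  (- (u t * ln (u t))) @[t --> F] --> - (l * ln l).
Proof.
move=> FF u01; rewrite le0r => /orP[/eqP ->|l0] ul; last first.
  apply: cvgN; apply: cvgM => //.
  by apply: (continuous_cvg _ _ ul); exact: continuous_ln.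
rewrite mul0r oppr0.
apply: (@squeeze_cvgr _ _ _ _ (fun=> 0) (fun t => 2 * Num.sqrt (u t))).
- near=> t; have /andP[ut0 ut1] := u01 t.
  by rewrite neg_xlnx_le// andbT oppr_ge0 mulr_ge0_le0// ln_le0.
- exact: cvg_cst.
- have : 2 * Num.sqrt (u t) @[t --> F] --> 2 * Num.sqrt 0.
    apply: cvgMr; apply: (continuous_cvg _ _ ul); exact: sqrt_continuous.
  by rewrite sqrtr0 mulr0.
Unshelve. all: by end_near. Qed.

End EntropyFunction.

(** * The limiting invariant content *)

Section Content.
Variables (R : realType) (A : finType) (W : subshift A).
Hypothesis W_gaps : forall N, exists k l,
  [/\ (N <= k)%N, (N <= l)%N & cover W k = cover W (k + l)].

Local Notation "! x" := (set_val x : config A) (at level 2, format "! x").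

(* The maximum with 0 ensures that a periodic point exists when the entropy is 0. *)
Lemma stage_exists n : exists k l p,
  [/\ (n.*2.+1 <= k)%N, (n <= l)%N, cover W k = cover W (k + l), (n <= p)%N &
      expR (Num.max 0 (htop R W - n.+1%:R^-1) * p.+1%:R) <= #|per W k p|%:R].
Proof.
have [k [l [nk nl kl]]] := W_gaps n.*2.+1; exists k, l.
case: k nk kl => // k nk kl.
have [h0|h0] := ltP 0 (htop R W).
  have [|p np pW] := @per_count_ge A W k R (Num.max 0 (htop R W - n.+1%:R^-1)) n.
    by rewrite gt_max h0 gtrBl invr_gt0 ltr0n.
  by exists p; split=> //; lia.
have [|p np pW] := @per_count_ge A W k R (htop R W - n.+1%:R^-1) n.
  by rewrite gtrBl invr_gt0 ltr0n.
exists p; split=> //; first by lia.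
rewrite max_l ?mul0r ?expR0 ?ler1n; last first.
  by rewrite subr_le0 (le_trans h0)// invr_ge0.
by rewrite -(ltr0n R) (lt_le_trans _ pW)// expR_gt0.
Qed.

Lemma invariant_content : exists m : set (points W) -> R,
  [/\ forall C, 0 <= m C, m setT = 1,
      forall C D, C `&` D = set0 -> m (C `|` D) = m C + m D,
      forall psi C, @is_automorphism A W psi -> window_set C ->
        m (psi @^-1` C) = m C &
      forall q, (0 < q)%N -> htop R W <=
        (\sum_(w : {ffun 'I_q -> A}) - (m (cylinder w) * ln (m (cylinder w)))) / q%:R].
Proof.
have /choice[k /choice[l /choice[p stP]]] := stage_exists.
have per0 n : (0 < #|per W (k n) (p n)|)%N.
  by have [_ _ _ _ pW] := stP n; rewrite -(ltr0n R) (lt_le_trans _ pW)// expR_gt0.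
have sx n : {s : {ffun 'I_(p n).+1 -> A} -> points W |
    forall c, c \in per W (k n) (p n) -> agree n (pext c) !(s c)}.
  by apply: cid; have [nk _ _ _ _] := stP n; exact: sample_exists.
pose s n := sval (sx n); have sP n := svalP (sx n).
pose e n := empirical R (k n) (s n).
have e0 n C : 0 <= e n C by exact: empirical_ge0.
have eT n : e n setT = 1 by exact: empiricalT.
have eU n C D : C `&` D = set0 -> e n (C `|` D) = e n C + e n D by exact: empiricalU.
have e01 C n : 0 <= e n C <= 1.
  by rewrite e0 -(eT n) -(setUv C) eU ?setICr// lerDl e0.
(* Along [U] the bounded values converge for all subsets at once; since [U] refines [\oo],
   identities valid from some stage on pass to the limit. *)
have [U [UU ooU]] := @ultraFilterLemma nat \oo _.
have /choice[m em] : forall C, exists l : R, (e ^~ C) @ U --> l.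
  by move=> C; apply: ultra_cvg; exact: e01.
have hR : hausdorff_space R by exact: Rhausdorff.
have lim_eq (u v : nat -> R) (a b : R) : (u @ U --> a) -> (v @ U --> b) ->
    (\forall n \near \oo, u n = v n) -> a = b.
  move=> ua vb uv; apply: (cvg_unique hR _ vb).
  apply: cvg_trans ua; apply: near_eq_cvg; exact: (ooU _ uv).
exists m; split=> //.
- move=> C; apply: (ler_cvg_to (cvg_cst 0) (em C)); exact: nearW.
- apply: (lim_eq _ (fun=> 1) _ 1 (em setT)); [exact: cvg_cst|exact: nearW].
- move=> C D CD; apply: (lim_eq _ _ _ _ (em (C `|` D)) (cvgD (em C) (em D))).
  by apply: nearW => n; exact: eU.
- move=> psi C psiA /window_setP[t tC].
  have [phi phiA psiK] := automorphism_inv psiA.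
  have [r1 r1F] := automorphism_block_map psiA.
  have [r2 r2G] := automorphism_block_map phiA.
  have [F psiF] := r1F _ (leq_maxl r1 r2); have [G phiG] := r2G _ (leq_maxr r1 r2).
  (* For the common radius [r], [n >= t + 4r] ensures [4r + 1 <= 2n + 1 <= k n], [2r <= n <= l n]
     and [t + r <= n]. *)
  apply: (lim_eq _ _ _ _ (em _) (em _)); exists (t + (maxn r1 r2).*2.*2)%N => // n /= tn.
  have [nk nl kl _ _] := stP n.
  by apply: (empirical_invariant R nk (per0 n) (sP n) psiA psiK psiF phiG _ _ kl tC); lia.
- move=> q q0.
  pose H n := (\sum_(w : {ffun 'I_q -> A}) - (e n (cylinder w) * ln (e n (cylinder w)))) / q%:R.
  have inv0 : n.+1%:R^-1 @[n --> \oo] --> (0 : R) := @cvg_harmonic R.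
  pose L n : R := (htop R W - n.+1%:R^-1) - (q%:R ^+ 2 * ln #|A|%:R) * n.+1%:R^-1.
  have Lh : L n @[n --> U] --> htop R W.
    suff : L n @[n --> \oo] --> htop R W by apply: cvg_trans => B /= /ooU.
    rewrite -[X in _ --> X]subr0 -[X in _ --> _ - X](mulr0 (q%:R ^+ 2 * ln #|A|%:R)).
    rewrite -[X in _ --> X - _]subr0.
    by apply: cvgB; [apply: cvgB => //; exact: cvg_cst|exact: cvgMr].
  have HU : H n @[n --> U] -->
      (\sum_(w : {ffun 'I_q -> A}) - (m (cylinder w) * ln (m (cylinder w)))) / q%:R.
    apply: cvgMl; apply: cvg_big => [|w _]; first exact: add_continuous.
    apply: cvg_xlnx; [exact: e01| |exact: em].
    by apply: (ler_cvg_to (cvg_cst 0) (em _)); exact: nearW.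
  apply: (ler_cvg_to Lh HU); apply: ooU; exists q => // n /= qn.
  have [nk nl kl np pW] := stP n.
  have := shannon_pword_ge nk (per0 n) np q0 _ pW; rewrite le_max lexx => /(_ isT).
  rewrite /H /shannon; under eq_bigr do rewrite -(empirical_cylinder R nk (per0 n) (sP n) _ (leqW qn)).
  apply: le_trans; rewrite /L lerD2r le_max lexx orbT//.
Qed.

End Content.

(** * From finitely additive contents to Borel measures *)

Section MeasurableWindows.
Variables (A : finType) (W : subshift A).

Lemma borel_window : (@open (points W)).-sigma.-measurable = <<s @window_set A W >>.
Proof.
apply/seteqP; split; apply: smallest_sub; try exact: smallest_sigma_algebra.
  move=> U /open_window[C Cw ->].
  have [_ _ big] := smallest_sigma_algebra setT (@window_set A W).
  by apply: big => i; exact: sub_sigma_algebra.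
by move=> C /window_set_open; exact: sub_sigma_algebra.
Qed.

Lemma measurable_window (C : set (borel_space W)) : window_set C -> measurable C.
Proof. by move=> Cw; rewrite borel_window; exact: sub_sigma_algebra. Qed.

Lemma measurable_automorphism (psi : points W -> points W) :
  is_automorphism psi -> @measurable_fun _ _ (borel_space W) (borel_space W) setT psi.
Proof.
move=> psiA; apply: (@measurability _ _ (borel_space W) (borel_space W) setT psi (@open (points W))) => //.
move=> _ [U oU <-]; rewrite setTI; apply: sub_sigma_algebra.
by apply: open_comp => // x _; have [c _ _] := psiA; exact: c.
Qed.

(** An alias on which the measurable sets are the algebra of window sets, the domain on which the
    content is extended. *)
Definition window_space : Type := points W.

HB.instance Definition _ := Pointed.on window_space.
HB.instance Definition _ := @isAlgebraOfSets.Build default_measure_display window_space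
  (@window_set A W) (@window_set0 A W) (@window_setU A W) (@window_setC A W).

End MeasurableWindows.

Section Extension.
Variables (R : realType) (A : finType) (W : subshift A) (m : set (points W) -> R).
Hypotheses (m_ge0 : forall C, 0 <= m C) (mT : m setT = 1).
Hypothesis mU : forall C D, C `&` D = set0 -> m (C `|` D) = m C + m D.

Let content (C : set (window_space W)) : \bar R := (m C)%:E.

Let content0 : content set0 = 0%E.
Proof.
have := mU (setI0 set0); rewrite setU0 => /eqP.
by rewrite -subr_eq0 opprD addNKr oppr_eq0 /content => /eqP ->.
Qed.

Let content_ge0 C : (0 <= content C)%E. Proof. by rewrite lee_fin. Qed.

(* By compactness, only finitely many terms of a partition of a window set into
   window sets are nonempty. *)
Let content_semi_sigma_additive : semi_sigma_additive content.
Proof.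
move=> F Fw tF UFw.
have [N FN] := window_set_bigcup UFw Fw (@subset_refl _ _).
have fin n : content (\bigcup_(i < n) F i) = (\sum_(0 <= i < n) content (F i))%E.
  elim: n => [|n IH]; first by rewrite big_geq// bigcup_mkord big_ord0.
  rewrite big_nat_recr//= -IH /content -EFinD -mU; last first.
    rewrite setI_bigcupl bigcup0// => i /= lt_in; move/trivIsetP : tF; apply => //.
    by rewrite ltn_eqF.
  by rewrite !bigcup_mkord big_ord_recr.
have -> : content (\bigcup_n F n) = content (\bigcup_(i < N) F i).
  by congr content; apply/seteqP; split => // x [i _ Fi]; exists i.
apply: cvg_near_cst; exists N => // n /= Nn.
rewrite -fin; congr content; apply/seteqP; split=> x [i iN Fi].
  by apply: FN; exists i.
by exists i => //; exact: leq_trans iN Nn.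
Qed.

HB.instance Definition _ := isMeasure.Build _ (window_space W) R content
  content0 content_ge0 content_semi_sigma_additive.

(** The Caratheodory extension lives on the sigma-algebra generated by the window sets;
    [borel_window] transports it to [borel_space W]. *)
Let extension (B : set (borel_space W)) : \bar R := measure_extension content B.

Let extension_semi_sigma_additive : semi_sigma_additive extension.
Proof.
move=> F Fm tF UFm; apply: (@measure_semi_sigma_additive _ _ _ (measure_extension content)) => //.
  by move=> i; have := Fm i; rewrite borel_window.
by have := UFm; rewrite borel_window.
Qed.

HB.instance Definition _ := isMeasure.Build _ (borel_space W) R extension
  (measure0 (measure_extension content)) (measure_ge0 (measure_extension content))
  extension_semi_sigma_additive.

Let extension_window C : window_set C -> extension C = (m C)%:E.
Proof. by move=> Cw; rewrite /extension /measure_extension measurable_mu_extE. Qed.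

Let extensionT : extension setT = 1%E.
Proof. by rewrite extension_window ?mT//; exact: window_setT. Qed.

HB.instance Definition _ := Measure_isProbability.Build _ (borel_space W) R extension
  extensionT.

Lemma content_extension : exists mu : probability (borel_space W) R,
  forall C, window_set C -> mu C = (m C)%:E.
Proof. by exists extension. Qed.

End Extension.

(** The pushforward and [mu] agree on window sets, which are stable under intersection and generate
    the Borel sets. *)
Lemma invariant_of_window (R : realType) (A : finType) (W : subshift A)
    (mu : probability (borel_space W) R) (psi : points W -> points W) :
  is_automorphism psi ->
  (forall C, window_set C -> mu (psi @^-1` C) = mu C) -> invariant_measure mu psi.
Proof.
move=> psiA mupsi B; rewrite borel_window => mB.
have mpsi := measurable_automorphism psiA.
pose nu : {measure set (borel_space W) -> \bar R} :=
  measure_function_pushforward__canonical__measure_function_Measure mu mpsi.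
apply: (@g_sigma_algebra_measure_unique _ R (borel_space W) (@window_set A W) _ (fun=> setT)
  _ _ nu mu) => //.
- by move=> C; exact: measurable_window.
- by move=> _; exact: window_setT.
- by rewrite bigcup_const.
- by move=> C D; exact: window_setI.
- by move=> _; change (mu setT < +oo)%E; rewrite probability_setT ltry.
Qed.

(** * Kolmogorov-Sinai entropy *)

Section FinitePartition.
Context {d : measure_display} {T : measurableType d}.

Lemma measurable_labels (I : finType) (xi : T -> I) (S : pred I) :
  finite_partition xi -> measurable (xi @^-1` [set i | S i]).
Proof.
move=> mxi; have -> : xi @^-1` [set i | S i] = \bigcup_(i in [set i | S i]) xi @^-1` [set i].
  by apply/seteqP; split=> [x Sx|x [i Si /= ->]//]; exists (xi x).
by apply: fin_bigcup_measurable.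
Qed.

Lemma finite_partition_comp (I J : finType) (xi : T -> I) (g : I -> J) :
  finite_partition xi -> finite_partition (g \o xi).
Proof.
move=> mxi j; have := measurable_labels (fun i => g i == j) mxi.
by congr measurable; apply/seteqP; split=> x /= /eqP.
Qed.

End FinitePartition.

Section FiniteMeasure.
Context {d : measure_display} {T : measurableType d} {R : realType}.
Variable mu : probability T R.

Let M (B : set T) : R := fine (mu B).

Lemma prob_fineK B : measurable B -> (M B)%:E = mu B.
Proof. by move=> mB; rewrite fineK// fin_num_measure. Qed.

Lemma prob_ge0 B : 0 <= M B. Proof. exact: fine_ge0. Qed.

Lemma prob_le B C : measurable B -> measurable C -> B `<=` C -> M B <= M C.
Proof.
by move=> mB mC BC; rewrite -lee_fin !prob_fineK// le_measure// inE.
Qed.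

Lemma probU_le B C : measurable B -> measurable C -> M (B `|` C) <= M B + M C.
Proof.
move=> mB mC; rewrite -lee_fin EFinD !prob_fineK//; last exact: measurableU.
exact: measureU2.
Qed.

Lemma probU B C : measurable B -> measurable C -> B `&` C = set0 ->
  M (B `|` C) = M B + M C.
Proof.
move=> mB mC BC; apply: EFin_inj; rewrite EFinD !prob_fineK//; last exact: measurableU.
exact: measureU.
Qed.

Lemma prob_bigcup_le (I : finType) (F : I -> set T) : (forall i, measurable (F i)) ->
  M (\bigcup_i F i) <= \sum_i M (F i).
Proof.
move=> mF; have -> : \bigcup_i F i = \big[setU/set0]_i F i.
  by rewrite -bigcup_seq; congr bigcup; apply/seteqP; split=> i _ //=; rewrite mem_index_enum.
suff [] : measurable (\big[setU/set0]_i F i) /\ M (\big[setU/set0]_i F i) <= \sum_i M (F i) by [].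
elim/big_ind2 : _ => [|B x C y [mB Bx] [mC Cy]|i _]; last by split.
  by rewrite /M measure0; split.
by split; [exact: measurableU|rewrite (le_trans (probU_le _ _))// lerD].
Qed.

Lemma prob_labels (I : finType) (xi : T -> I) (S : pred I) : finite_partition xi ->
  M (xi @^-1` [set i | S i]) = \sum_(i | S i) M (xi @^-1` [set i]).
Proof.
move=> mxi; have eS s : xi @^-1` [set i | i \in s] = xi @^-1` [set i | mem s i] by [].
rewrite -big_filter; have := filter_uniq S (index_enum_uniq I).
rewrite (_ : [set i | S i] = [set i | mem [seq i <- index_enum I | S i] i]); last first.
  by apply/seteqP; split=> i /=; rewrite mem_filter mem_index_enum andbT.
elim: [seq i <- _ | S i] => [_|i s IH /= /andP[nis us]].
  rewrite big_nil (_ : _ @^-1` _ = set0) /M ?measure0//.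
  by apply/seteqP; split.
rewrite big_cons -IH// -probU//; [congr M|exact: measurable_labels|].
  apply/seteqP; split=> x /=; rewrite inE; first by case/orP => [/eqP|]; [left|right].
  by case=> [->|->]; rewrite ?eqxx ?orbT.
by apply/seteqP; split=> // x [/= -> xs]; move: nis; rewrite xs.
Qed.

Definition label_law (I : finType) (xi : T -> I) (i : I) : R := M (xi @^-1` [set i]).

Lemma label_law_ge0 (I : finType) (xi : T -> I) i : 0 <= label_law xi i.
Proof. exact: prob_ge0. Qed.

Lemma label_law1 (I : finType) (xi : T -> I) : finite_partition xi ->
  \sum_i label_law xi i = 1.
Proof.
move=> mxi; rewrite -(prob_labels predT mxi).
have <- : M setT = 1 by rewrite /M probability_setT.
by congr M; apply/seteqP.
Qed.

Lemma label_law_comp (I J : finType) (xi : T -> I) (g : I -> J) j : finite_partition xi ->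
  label_law (g \o xi) j = law (label_law xi) g j.
Proof.
move=> mxi; rewrite /law -(prob_labels (fun i => g i == j) mxi).
rewrite /label_law; congr M; by apply/seteqP; split=> x /= /eqP.
Qed.

(** The bridge to finite probability: all coarsenings of [xi] become random variables on the finite
    space of its labels, where the Shannon inequalities apply. *)
Lemma partition_entropy_comp (I J : finType) (xi : T -> I) (g : I -> J) :
  finite_partition xi -> partition_entropy mu (g \o xi) = shannon (label_law xi) g.
Proof.
by move=> mxi; apply: eq_bigr => j _; rewrite -label_law_comp.
Qed.

Lemma partition_entropy_ge0 (I : finType) (xi : T -> I) : finite_partition xi ->
  0 <= partition_entropy mu xi.
Proof.
move=> mxi; apply: sumr_ge0 => i _; rewrite -mulrN mulr_ge0 ?prob_ge0// oppr_ge0.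
by rewrite ln_le0// -lee_fin prob_fineK// probability_le1.
Qed.

End FiniteMeasure.

(** * Entropy of itineraries under a measure-preserving map *)

Section Itineraries.
Context {d : measure_display} {T : measurableType d} {R : realType}.
Variables (mu : probability T R) (f : T -> T).
Hypothesis mf : measurable_fun setT f.
Hypothesis muf : forall B, measurable B -> mu (f @^-1` B) = mu B.

Lemma finite_partition_iter (I : finType) (xi : T -> I) n :
  finite_partition xi -> finite_partition (xi \o iter n f).
Proof.
move=> mxi; elim: n => [//|n IH] i.
have := mf measurableT (IH i); rewrite setTI; congr measurable.
by apply/seteqP; split=> x /=; rewrite -iterSr.
Qed.

Lemma label_law_iter (I : finType) (xi : T -> I) n i :
  finite_partition xi -> label_law mu (xi \o iter n f) i = label_law mu xi i.
Proof.
move=> mxi; elim: n => [//|n IH]; rewrite -IH /label_law.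
rewrite -(muf (finite_partition_iter n mxi i)); congr (fine (mu _)).
by apply/seteqP; split=> x /=; rewrite -iterSr.
Qed.

Lemma partition_entropy_iter (I : finType) (xi : T -> I) n :
  finite_partition xi -> partition_entropy mu (xi \o iter n f) = partition_entropy mu xi.
Proof.
by move=> mxi; apply: eq_bigr => i _; have := label_law_iter n i mxi; rewrite /label_law => ->.
Qed.

Lemma finite_partition_itinerary (I : finType) (xi : T -> I) n :
  finite_partition xi -> finite_partition (itinerary f xi n).
Proof.
move=> mxi w.
have -> : itinerary f xi n @^-1` [set w] =
    \bigcap_(i : 'I_n) (xi \o iter i f) @^-1` [set w i].
  apply/seteqP; split=> [x /= <- i _|x xw]; first by rewrite /= ffunE.
  by apply/ffunP => i; rewrite ffunE; exact: xw.
apply: fin_bigcap_measurable => // i _; exact: finite_partition_iter.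
Qed.

Lemma entropy_itineraryD (I : finType) (xi : T -> I) m n : finite_partition xi ->
  partition_entropy mu (itinerary f xi (m + n)) <=
  partition_entropy mu (itinerary f xi m) + partition_entropy mu (itinerary f xi n).
Proof.
move=> mxi; set z := itinerary f xi (m + n).
have mz : finite_partition z := finite_partition_itinerary mxi.
pose g1 (w : {ffun 'I_(m + n) -> I}) : {ffun 'I_m -> I} := [ffun i => w (lshift n i)].
pose g2 (w : {ffun 'I_(m + n) -> I}) : {ffun 'I_n -> I} := [ffun i => w (rshift m i)].
have e1 : itinerary f xi m = g1 \o z.
  by apply/funext => x; apply/ffunP => i; rewrite !ffunE.
have e2 : itinerary f xi n \o iter m f = g2 \o z.
  by apply/funext => x; apply/ffunP => i; rewrite !ffunE -iterD addnC.
rewrite -(@partition_entropy_iter _ (itinerary f xi n) m (finite_partition_itinerary mxi)) e1 e2.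
rewrite !(partition_entropy_comp mu _ mz) -[z in leLHS]/(id \o z) (partition_entropy_comp mu _ mz).
have P0 := label_law_ge0 mu z; have P1 := label_law1 mu mz.
apply: le_trans (shannonD P0 P1 _ _); apply: (shannon_le P0) => w w' [] /ffunP w1 /ffunP w2.
apply/ffunP => i; case: (splitP i) => j ij.
  by have := w1 j; rewrite !ffunE; congr (_ = _); congr (_ _); apply: val_inj.
by have := w2 j; rewrite !ffunE; congr (_ = _); congr (_ _); apply: val_inj.
Qed.

Lemma entropy_wrt_le (I : finType) (xi : T -> I) n : finite_partition xi -> (0 < n)%N ->
  entropy_wrt mu f xi <= partition_entropy mu (itinerary f xi n) / n%:R.
Proof.
move=> mxi n0; apply: fekete_le => // [k|k l].
  exact/partition_entropy_ge0/finite_partition_itinerary.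
exact: entropy_itineraryD.
Qed.

Lemma entropy_wrt_ge (I : finType) (xi : T -> I) h : finite_partition xi ->
  (forall n, (0 < n)%N -> h <= partition_entropy mu (itinerary f xi n) / n%:R) ->
  h <= entropy_wrt mu f xi.
Proof.
move=> mxi hn; apply: fekete_ge => // [k|k l].
  exact/partition_entropy_ge0/finite_partition_itinerary.
exact: entropy_itineraryD.
Qed.

(** For [z = (xi, eta)] this is the finite form of [h(xi) <= h(eta) + H(xi | eta)]: by
    [shannon_cond], each further time step adds at most [H(z) - H(eta)] to the conditional entropy
    of the itineraries. *)
Lemma entropy_itinerary_joint (I J : finType) (z : T -> I * J) n : finite_partition z ->
  partition_entropy mu (itinerary f (fst \o z) n) <=
  partition_entropy mu (itinerary f (snd \o z) n) +
  n%:R * (partition_entropy mu z - partition_entropy mu (snd \o z)).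
Proof.
move=> mz; apply: (@le_trans _ _ (partition_entropy mu (itinerary f z n))).
  pose g (w : {ffun 'I_n -> I * J}) : {ffun 'I_n -> I} := [ffun i => (w i).1].
  have -> : itinerary f (fst \o z) n = g \o itinerary f z n.
    by apply/funext => x; apply/ffunP => i; rewrite !ffunE.
  have mi : finite_partition (itinerary f z n) := finite_partition_itinerary mz.
  rewrite (partition_entropy_comp mu _ mi) -[itinerary f z n in leRHS]/(id \o itinerary f z n).
  rewrite (partition_entropy_comp mu _ mi); apply: (shannon_le (label_law_ge0 mu _)).
  by move=> w w' ->.
elim: n => [|n IH].
  rewrite mul0r addr0.
  pose g (w : {ffun 'I_0 -> J}) := itinerary f z 0 point.
  have mi : finite_partition (itinerary f (snd \o z) 0) :=
    finite_partition_itinerary (finite_partition_comp snd mz).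
  have -> : itinerary f z 0 = g \o itinerary f (snd \o z) 0.
    by apply/funext => x; apply/ffunP => -[].
  rewrite (partition_entropy_comp mu _ mi) -[itinerary _ _ _ in leRHS]/(id \o itinerary f (snd \o z) 0).
  rewrite (partition_entropy_comp mu _ mi); apply: (shannon_le (label_law_ge0 mu _)).
  by move=> w w' ->.
set y := itinerary f z n.+1.
have my : finite_partition y := finite_partition_itinerary mz.
pose U (w : {ffun 'I_n.+1 -> I * J}) : {ffun 'I_n -> I * J} := [ffun i => w (widen_ord (leqnSn n) i)].
pose V (w : {ffun 'I_n.+1 -> I * J}) := w ord_max.
pose a m (w : {ffun 'I_m -> I * J}) : {ffun 'I_m -> J} := [ffun i => (w i).2].
have yU : itinerary f z n = U \o y.
  by apply/funext => x; apply/ffunP => i; rewrite !ffunE.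
have yV : z \o iter n f = V \o y by apply/funext => x; rewrite /= /V ffunE.
have ya m : itinerary f (snd \o z) m = a m \o itinerary f z m.
  by apply/funext => x; apply/ffunP => i; rewrite !ffunE.
have P0 := label_law_ge0 mu y.
have := shannon_cond P0 U V (a n) snd.
have -> : shannon (label_law mu y) U = partition_entropy mu (itinerary f z n).
  by rewrite yU partition_entropy_comp.
have -> : shannon (label_law mu y) (a n \o U) = partition_entropy mu (itinerary f (snd \o z) n).
  by rewrite ya yU -partition_entropy_comp.
have -> : shannon (label_law mu y) V = partition_entropy mu z.
  by rewrite -(partition_entropy_iter n mz) yV partition_entropy_comp.
have -> : shannon (label_law mu y) (snd \o V) = partition_entropy mu (snd \o z).
  rewrite -(partition_entropy_iter n (finite_partition_comp snd mz)).
  by rewrite -[_ \o iter n f]/(snd \o (z \o iter n f)) yV -partition_entropy_comp.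
have : partition_entropy mu y <= shannon (label_law mu y) (fun w => (U w, V w)).
  rewrite -[y in leLHS]/(id \o y) (partition_entropy_comp mu _ my).
  apply: (shannon_le P0) => w w' [] /ffunP UV Vw; apply/ffunP => i.
  have [iN|iN] := ltnP i n.
    by have := UV (Ordinal iN); rewrite !ffunE; congr (_ = _); congr (_ _); apply: val_inj.
  have -> : i = ord_max by apply: val_inj => /=; have := ltn_ord i; lia.
  exact: Vw.
have : shannon (label_law mu y) (fun w => (a n (U w), (V w).2)) <=
    partition_entropy mu (itinerary f (snd \o z) n.+1).
  rewrite ya (partition_entropy_comp mu _ my).
  apply: (shannon_le P0) => w w' /ffunP ww; congr pair.
    by apply/ffunP => i; have := ww (widen_ord (leqnSn n) i); rewrite !ffunE.
  by have := ww ord_max; rewrite !ffunE.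
rewrite -natr1 mulrDl mul1r; lra.
Qed.

End Itineraries.

(** * A Fano-type bound on conditional entropy *)

Section Fano.
Variables (R : realType) (I : finType) (P : I * I -> R) (e : R).
Hypotheses (P_ge0 : forall w, 0 <= P w) (P1 : \sum_w P w = 1).
Hypothesis Pe : \sum_(w | w.1 != w.2) P w <= e.

(** The left side is the entropy of the first coordinate given the second. A diagonal term is at
    most [L w - P w], and these sum to at most [e]; an off-diagonal term has mass at most [e] and
    contributes at most [2 * sqrt e]. *)
Lemma shannon_fano :
  shannon P id - shannon P snd <= e + #|{: I * I}|%:R * (2 * Num.sqrt e).
Proof.
have e0 : 0 <= e by apply: le_trans Pe; exact: sumr_ge0.
pose L (w : I * I) := law P snd w.2.
have PL w : P w <= L w by exact: (le_law P_ge0 snd w).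
have L1 w : L w <= 1.
  by rewrite -P1 [leRHS](bigID (fun v => v.2 == w.2))/= lerDl sumr_ge0.
have lid w : law P id w = P w by rewrite /law big_pred1_eq.
rewrite !shannonE -sumrB.
apply: (@le_trans _ _ (\sum_w ((if w.1 == w.2 then L w - P w else 0) + 2 * Num.sqrt e))).
  apply: ler_sum => w _; rewrite lid -/(L w).
  have s0 : 0 <= 2 * Num.sqrt e by rewrite mulr_ge0// sqrtr_ge0.
  have := P_ge0 w; rewrite le0r => /orP[/eqP Pw0|Pw].
    rewrite Pw0 !mul0r subrr addr_ge0//; case: ifP => // _.
    by rewrite subr0 -Pw0.
  have Lw : 0 < L w by exact: lt_le_trans (PL w).
  case: ifPn => [_|ne].
    rewrite ler_wpDr// (_ : _ - _ = P w * ln (L w / P w)).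
      apply: (le_trans (ler_wpM2l (ltW Pw) (ln_le_sub1 _))); first by rewrite divr_gt0.
      by rewrite mulrBr mulr1 mulrCA mulfV ?mulr1// gt_eqF.
    by rewrite ln_div ?posrE//; ring.
  rewrite add0r opprK.
  apply: (@le_trans _ _ (- (P w * ln (P w)))).
    by rewrite gerDl mulr_ge0_le0 ?(ltW Pw)// ln_le0.
  apply: (le_trans (neg_xlnx_le (ltW Pw))); rewrite ler_pM2l// ler_sqrt//.
  by apply: le_trans Pe; rewrite (bigD1 w)//= lerDl sumr_ge0.
rewrite big_split/= sumr_const -[_ *+ _]mulr_natl lerD2r -big_mkcond/= sumrB.
have -> : \sum_(w | w.1 == w.2) L w = 1.
  rewrite big_mkcond -[RHS]P1 [RHS](partition_big snd predT)//=.
  pose D i j : R := if i == j then law P snd j else 0.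
  have -> : \sum_w (if w.1 == w.2 then L w else 0) = \sum_w D w.1 w.2 by [].
  rewrite -(pair_bigA _ D) exchange_big/=; apply: eq_bigr => j _.
  by rewrite -big_mkcond big_pred1_eq.
by rewrite lerBlDl -P1 (bigID (fun w => w.1 == w.2))/= lerD2l.
Qed.

End Fano.

(** * Approximation of Borel partitions by window partitions *)

Section Approximation.
Variables (R : realType) (A : finType) (W : subshift A) (mu : probability (borel_space W) R).

Let M (B : set (borel_space W)) : R := fine (mu B).

Definition symdiff (B C : set (points W)) := (B `\` C) `|` (C `\` B).

Lemma measurable_symdiff (B C : set (borel_space W)) :
  measurable B -> measurable C -> measurable (symdiff B C : set (borel_space W)).
Proof. by move=> mB mC; apply: measurableU; exact: measurableD. Qed.

Lemma window_approx (B : set (borel_space W)) (e : R) : measurable B -> 0 < e ->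
  exists2 C : set (points W), window_set C & M (symdiff B C) < e.
Proof.
(* The approximable sets form a sigma-algebra that contains the window sets. *)
pose G : set (set (borel_space W)) := [set B : set (borel_space W) | measurable B /\ forall e : R, 0 < e ->
  exists2 C : set (points W), window_set C & M (symdiff B C) < e].
have bigU (F : nat -> set (borel_space W)) : (forall i, G (F i)) -> G (\bigcup_i F i).
  move=> FG; have mF i : measurable (F i) by have [] := FG i.
  split; first exact: bigcupT_measurable.
  move=> d d0; have d20 : 0 < d / 2 by rewrite divr_gt0.
  pose E n := \bigcup_(i < n) F i.
  have mE n : measurable (E n) by rewrite /E bigcup_mkord; exact: bigsetU_measurable.
  have EF : \bigcup_n E n = \bigcup_n F n.
    apply/seteqP; split=> x; first by case=> n _ [i _ Fi]; exists i.
    by case=> n _ Fn; exists n.+1 => //; exists n => /=.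
  (* One half of the error pays for truncating the union, by continuity from below. *)
  have [N EN] : exists N, M ((\bigcup_n F n) `\` E N) < d / 2.
    have muE : mu (E n) @[n --> \oo] --> mu (\bigcup_n E n).
      apply: nondecreasing_cvg_mu => //; first exact: bigcupT_measurable.
      move=> m n mn; apply/subsetPset => x [i im Fi]; exists i => //.
      exact: leq_trans im mn.
    rewrite EF in muE.
    have ME : M (E n) @[n --> \oo] --> M (\bigcup_n F n).
      apply: fine_cvg; rewrite prob_fineK//; exact: bigcupT_measurable.
    have /cvgrPdist_lt/(_ _ d20)[N _ /(_ N (leqnn N))] := ME => MN.
    exists N; apply: le_lt_trans MN; rewrite ler_normr; apply/orP; left.
    rewrite lerBrDr addrC -(@probU _ _ _ mu) //.
    - rewrite setDUK//; move=> x [i _ Fi]; by exists i.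
    - by apply: measurableD => //; exact: bigcupT_measurable.
    - by rewrite setIC setDKI.
  (* The [N] remaining sets share the other half; [N.+1] keeps the tolerance positive when [N] is
     0. *)
  have dN0 : 0 < d / 2 / N.+1%:R by rewrite divr_gt0.
  have /choice[C CP] : forall i, exists C : set (points W),
      window_set C /\ M (symdiff (F i) C) < d / 2 / N.+1%:R.
    by move=> i; have [_ /(_ _ dN0)[C Cw FC]] := FG i; exists C.
  exists (\bigcup_(i < N) C i).
    rewrite bigcup_mkord; apply: big_ind => [||i _]; [exact: window_set0|exact: window_setU|].
    by have [] := CP i.
  have mC i : measurable (C i : set (borel_space W)).
    by apply: measurable_window; have [] := CP i.
  have mFC (i : 'I_N) := measurable_symdiff (mF i) (mC i).
  have mS : measurable (\bigcup_(i : 'I_N) symdiff (F i) (C i) : set (borel_space W)).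
    exact: fin_bigcup_measurable.
  have MS := prob_bigcup_le mu mFC.
  have mCN : measurable (\bigcup_(i < N) C i : set (borel_space W)).
    by rewrite bigcup_mkord; exact: bigsetU_measurable.
  have mFF : measurable (\bigcup_n F n) by exact: bigcupT_measurable.
  have mFE : measurable ((\bigcup_n F n) `\` E N) by exact: measurableD.
  rewrite [ltRHS]splitr.
  apply: (@le_lt_trans _ _ (M ((\bigcup_n F n) `\` E N) + M (\bigcup_i symdiff (F (i : 'I_N)) (C i)))).
    apply: le_trans (probU_le _ mFE mS); apply: prob_le.
    - exact: measurable_symdiff.
    - exact: measurableU.
    - move=> x [[[n _ Fn] nC]|[[i iN Ci] nF]].
        have [[i iN Fi]|nE] := pselect (E N x).
          right; exists (Ordinal iN) => //; left; split=> // Ci; apply: nC.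
          by exists i.
        by left; split=> //; exists n.
      by right; exists (Ordinal iN) => //; right; split=> // Fi; apply: nF; exists i.
  rewrite ltr_leD//; apply: (le_trans MS).
  apply: (@le_trans _ _ (\sum_(i < N) d / 2 / N.+1%:R)).
    by apply: ler_sum => i _; apply: ltW; have [] := CP i.
  rewrite sumr_const card_ord -[_ *+ _]mulr_natr -mulrA ler_piMr ?(ltW d20)//.
  by rewrite mulrC ler_pdivrMr// mul1r ler_nat.
suff sG : <<s @window_set A W >> `<=` G.
  by rewrite borel_window => /sG[_]; apply.
apply: smallest_sub.
  split.
  - split=> // d d0; exists set0; first exact: window_set0.
    by rewrite /symdiff setDv setU0 /M measure0.
  - move=> C [mC Cd]; rewrite setTD; split; first exact: measurableC.
    move=> d /Cd[D Dw CD]; exists (~` D); first exact: window_setC.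
    rewrite (_ : symdiff _ _ = symdiff C D)//; apply/seteqP; split=> x.
      by case=> -[h1 h2]; [right|left]; split=> //; exact: contrapT.
    by case=> -[h1 h2]; [right|left]; split=> //; exact.
  - exact: bigU.
move=> C Cw; split; first exact: measurable_window.
move=> d d0; exists C => //.
by rewrite /symdiff setDv setU0 /M measure0.
Qed.

Lemma label_approx (I : finType) (xi : borel_space W -> I) (e : R) :
  finite_partition xi -> 0 < e ->
  exists eta : points W -> I,
    [/\ forall i, window_set (eta @^-1` [set i]),
      measurable ([set x | xi x != eta x] : set (borel_space W)) &
      M [set x | xi x != eta x] <= e].
Proof.
move=> mxi e0; pose i0 := xi point.
have I0 : 0 < #|I|%:R :> R by rewrite ltr0n; apply/card_gt0P; exists i0.
have eI0 : 0 < e / #|I|%:R by rewrite divr_gt0.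
have /choice[C CP] : forall i, exists C : set (points W),
    window_set C /\ M (symdiff (xi @^-1` [set i]) C) < e / #|I|%:R.
  by move=> i; have [C] := window_approx (mxi i) eI0; exists C.
(* The sets [C i] may overlap or miss points. Away from all the symmetric differences, exactly one
   of them contains [x], the one with index [xi x], so neither the choice nor the default matters
   there. *)
pose eta (x : points W) := odflt i0 [pick i | `[< C i x >]].
have weta i : window_set (eta @^-1` [set i]).
  have /choice[r rP] : forall i, exists r, forall x y : points W,
      agree r (set_val x) (set_val y) -> C i x <-> C i y.
    by move=> j; have [/window_setP] := CP j.
  exists (\max_j r j) => x y xy /= <-; rewrite /eta; congr odflt.
  apply: eq_pick => j; apply: asbool_equiv_eq; apply: iff_sym; apply: rP.
  by apply: agree_le xy; exact: leq_bigmax.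
have meta : @finite_partition _ (borel_space W) _ eta.
  by move=> i; exact: measurable_window.
have mne : measurable ([set x | xi x != eta x] : set (borel_space W)).
  have -> : [set x | xi x != eta x] =
      \bigcup_(i : I) ((xi @^-1` [set i]) `&` ~` (eta @^-1` [set i])).
    apply/seteqP; split=> [x /eqP ne|x [i _ [/= <- /eqP]]]; last by rewrite eq_sym.
    by exists (xi x) => //; split=> //= ex; apply: ne.
  apply: fin_bigcup_measurable => // i _.
  by apply: measurableI => //; apply: measurableC; exact: meta.
exists eta; split=> //.
have mC i : measurable (C i : set (borel_space W)).
  by apply: measurable_window; have [] := CP i.
have mxC i := measurable_symdiff (mxi i) (mC i).
have mS : measurable (\bigcup_i symdiff (xi @^-1` [set i]) (C i) : set (borel_space W)).
  exact: fin_bigcup_measurable.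
have MS := prob_bigcup_le mu mxC.
apply: (@le_trans _ _ (\sum_(i : I) (e / #|I|%:R))); last first.
  by rewrite sumr_const -[_ *+ _]mulr_natr divfK// gt_eqF.
apply: (@le_trans _ _ (M (\bigcup_i symdiff (xi @^-1` [set i]) (C i)))).
  apply: prob_le => // x /eqP ne; apply: contrapT => nS.
  have Cxi i : C i x <-> xi x = i.
    split=> [Ci|xii]; apply: contrapT => h; apply: nS; exists i => //.
      by right.
    by left.
  apply: ne; rewrite /eta; case: pickP => [i /asboolP/Cxi//|/(_ (xi x))].
  by move/asboolP => []; apply/Cxi.
by apply: (le_trans MS); apply: ler_sum => i _; apply: ltW; have [] := CP i.
Qed.

End Approximation.

(** * Comparison with topological entropy *)

Section MaximalEntropy.
Variables (R : realType) (A : finType) (W : subshift A) (mu : probability (borel_space W) R).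

Local Notation "! x" := (set_val x : config A) (at level 2, format "! x").

Let f : borel_space W -> borel_space W := @shift_points A W.

Hypothesis muf : invariant_measure mu (@shift_points A W).

Let mf : measurable_fun setT f. Proof. exact: measurable_automorphism (shift_automorphism W). Qed.

Lemma iter_shift_points n (x : points W) : !(iter n (@shift_points A W) x) = shiftz n%:Z !x.
Proof.
elim: n => [|n IH]; first by apply/funext => k; rewrite /shiftz addr0.
by rewrite iterS val_shift_points IH; apply/funext => k; rewrite /left_shift /shiftz; congr (!x _); lia.
Qed.

(** If [eta] reads the window [[-r, r]], an itinerary of length [n] is determined by a word of
    length [n + 2r], so at most that many itineraries have positive probability. *)
Lemma window_entropy_le (I : finType) (eta : points W -> I) :
  (forall i, window_set (eta @^-1` [set i])) ->
  exists r, forall n, partition_entropy mu (itinerary f eta n) <=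
    ln (complexity W (n + r))%:R.
Proof.
move=> weta.
have /choice[s sP] : forall i, exists s, forall x y : points W,
    agree s !x !y -> eta x = i <-> eta y = i.
  by move=> i; have /window_setP := weta i.
pose r := \max_i s i.
have rP (x y : points W) : agree r !x !y -> eta x = eta y.
  by move=> xy; apply/esym/(sP (eta x) x y) => //; apply: agree_le xy; exact: leq_bigmax.
exists r.*2 => n.
have meta : @finite_partition _ (borel_space W) _ eta.
  by move=> i; exact: measurable_window.
have mi : finite_partition (itinerary f eta n) := finite_partition_itinerary mf meta.
set P := label_law mu (itinerary f eta n).
have P0 w : 0 <= P w by exact: label_law_ge0.
rewrite -[itinerary f eta n]/(id \o itinerary f eta n) (partition_entropy_comp mu _ mi).
apply: (le_trans (shannon_le_ln P0 (label_law1 mu mi) (S := [pred w | 0 < P w]) _)) => //.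
pose S := [pred w | 0 < P w]; rewrite -/S.
have c0 : (0 < #|S|)%N.
  apply/card_gt0P; apply/not_existsP => nP; have := label_law1 mu mi.
  rewrite big1 => [/eqP|w _]; first by rewrite eq_sym oner_eq0.
  by apply/eqP; rewrite eq_le P0 andbT leNgt; apply/negP => Pw; apply: (nP w).
rewrite ler_ln ?posrE ?ltr0n ?complexity_gt0// ler_nat.
have wordn (x : points W) : size (word_at !x (- r%:Z) (n + r.*2)) == (n + r.*2)%N.
  by rewrite size_mkseq.
have /choice[h hP] : forall w : {ffun 'I_n -> I}, exists t : (n + r.*2).-tuple A, 0 < P w ->
    exists2 x : points W, itinerary f eta n x = w & t = Tuple (wordn x).
  move=> w; have [Pw|] := boolP (0 < P w); last by exists (Tuple (wordn point)).
  have /set0P[x xw] : itinerary f eta n @^-1` [set w] != set0.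
    by apply: contraTneq Pw => w0; rewrite /P /label_law w0 measure0 ltxx.
  by exists (Tuple (wordn x)) => _; exists x.
rewrite /complexity -(@card_in_image _ _ h) => [|w w'].
  apply/subset_leq_card/fintype.subsetP => t /fintype.imageP[w /hP[x _ ->] ->]; rewrite inE.
  exact: (language_word_at (- r%:Z) (n + r.*2) (points_in x)).
move=> /hP[x <- ->] /hP[y <- ->] [] /eqon_word xy; apply/ffunP => i; rewrite !ffunE.
apply: rP => k kr; rewrite !iter_shift_points /shiftz; apply: xy.
have := ltn_ord i; lia.
Qed.

(** Replacing [xi] by a nearby window labelling [eta] costs at most [e] per time step, and the
    itineraries of [eta] are controlled by words whose length exceeds theirs by a constant. *)
Lemma entropy_wrt_le_htop (I : finType) (xi : borel_space W -> I) :
  finite_partition xi -> entropy_wrt mu f xi <= htop R W.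
Proof.
move=> mxi; apply/ler_addgt0Pr => e e0.
pose c : R := #|{: I * I}|%:R.
have c0 : 0 <= c by [].
(* Chosen so that [2 * (c + 1) * b = e / 2]; together with [sqrt d <= b] and [d <= e / 2] this keeps
   the bound of [shannon_fano] below [e]. *)
pose b : R := e / (4 * (c + 1)).
have b0 : 0 < b by rewrite divr_gt0// mulr_gt0// ltr_wpDl.
pose d : R := Num.min (e / 2) (b ^+ 2).
have d0 : 0 < d by rewrite lt_min divr_gt0// exprn_gt0.
have de : d + c * (2 * Num.sqrt d) <= e.
  have sd : Num.sqrt d <= b.
    by rewrite -[leRHS]ger0_norm ?(ltW b0)// -sqrtr_sqr ler_sqrt ?exprn_ge0 ?(ltW b0)// ge_min lexx orbT.
  have be : c * (2 * b) <= e / 2.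
    have -> : e / 2 = (c + 1) * (2 * b).
      by rewrite /b; field; rewrite gt_eqF// ltr_wpDl.
    apply: ler_wpM2r; first by rewrite mulr_ge0// ltW.
    by rewrite lerDl.
  have dd : d <= e / 2 by rewrite ge_min lexx.
  have := ler_wpM2l c0 (ler_wpM2l (ltW (ltr0n R 2)) sd); lra.
have [eta [weta mne ne]] := label_approx mu mxi d0.
have meta : @finite_partition _ (borel_space W) _ eta.
  by move=> i; exact: measurable_window.
pose z (x : borel_space W) := (xi x, eta x).
have mz : finite_partition z.
  move=> [i j]; rewrite (_ : _ @^-1` _ = (xi @^-1` [set i]) `&` (eta @^-1` [set j])).
    by apply: measurableI => //; exact: meta.
  by apply/seteqP; split=> x; rewrite /z /=; [case=> <- <-|case=> -> ->].
have zH : partition_entropy mu z - partition_entropy mu (snd \o z) <= e.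
  rewrite -[X in partition_entropy _ X - _]/(id \o z) !(partition_entropy_comp mu _ mz).
  apply: le_trans de; apply: (shannon_fano (label_law_ge0 mu z) (label_law1 mu mz)).
  by rewrite -(prob_labels mu (fun w => w.1 != w.2) mz).
have [r rP] := window_entropy_le weta.
have lim : (ln (complexity W n)%:R / n%:R + ln (complexity W r)%:R * n%:R^-1 + e : R)
    @[n --> \oo] --> htop R W + ln (complexity W r)%:R * 0 + e.
  apply: cvgD; last exact: cvg_cst.
  apply: cvgD; first exact: htop_cvg.
  by apply: cvgMr; rewrite -cvg_shiftS; exact: cvg_harmonic.
rewrite mulr0 addr0 in lim.
apply: (ler_cvg_to (cvg_cst (entropy_wrt mu f xi)) lim); exists 1%N => // n /= n0.
have nR : 0 < n%:R :> R by rewrite ltr0n.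
apply: (le_trans (entropy_wrt_le mf muf mxi n0)).
rewrite ler_pdivrMr// !mulrDl !mulfVK ?gt_eqF//.
have h1 := entropy_itinerary_joint mf muf n mz.
apply: (le_trans h1); rewrite lerD//; last by rewrite mulrC ler_wpM2r// ltW.
by apply: (le_trans (rP n)); exact: ln_complexityD.
Qed.

Hypothesis mu_cylinder : forall q, (0 < q)%N -> htop R W <=
  (\sum_(w : {ffun 'I_q -> A}) - (fine (mu (cylinder w)) * ln (fine (mu (cylinder w))))) / q%:R.

Lemma maximal_entropy_of_cylinders : maximal_entropy mu.
Proof.
split=> //; apply/eqP; rewrite eq_le; apply/andP; split.
  apply: ub_ereal_sup => _ [k [xi [mxi ->]]]; rewrite lee_fin.
  exact: entropy_wrt_le_htop.
pose letter (x : borel_space W) : A := !x 0.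
have mletter : finite_partition letter.
  move=> a; apply: measurable_window; exists 0%N => x y xy.
  by rewrite /= /letter => <-; apply/esym/xy.
(* [ks_entropy] ranges over labellings by ordinals, so the letters are numbered; the atoms do not
   change. *)
pose xi (x : borel_space W) := enum_rank (letter x).
have mxi : finite_partition xi.
  exact: (finite_partition_comp enum_rank mletter).
apply: (@le_trans _ _ (entropy_wrt mu f xi)%:E); last first.
  by apply: ereal_sup_ubound; exists #|A|, xi.
rewrite lee_fin; apply: (entropy_wrt_ge mf muf mxi) => q q0.
apply: (le_trans (mu_cylinder q0)); rewrite ler_pM2r ?invr_gt0 ?ltr0n//.
pose g (w : {ffun 'I_q -> A}) : {ffun 'I_q -> 'I_#|A|} := [ffun i => enum_rank (w i)].
have mi : finite_partition (itinerary f letter q) := finite_partition_itinerary mf mletter.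
have -> : itinerary f xi q = g \o itinerary f letter q.
  by apply/funext => x; apply/ffunP => i; rewrite !ffunE.
rewrite (partition_entropy_comp mu _ mi).
apply: (@le_trans _ _ (partition_entropy mu (id \o itinerary f letter q))); last first.
  rewrite (partition_entropy_comp mu _ mi); apply: (shannon_le (label_law_ge0 mu _)).
  move=> w w' /ffunP ww; apply/ffunP => i; have := ww i; rewrite !ffunE.
  exact: enum_rank_inj.
rewrite le_eqVlt; apply/orP; left; apply/eqP/eq_bigr => w _.
suff -> : cylinder w = (id \o itinerary f letter q) @^-1` [set w] by [].
apply/seteqP; split=> x /=.
  move=> xw; apply/ffunP => i; rewrite ffunE /letter iter_shift_points /shiftz add0r.
  exact: xw.
by move=> <- i; rewrite ffunE /letter iter_shift_points /shiftz add0r.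
Qed.

End MaximalEntropy.

(** * Conclusion for subshifts with late and long constant blocks in their SFT cover *)

Lemma characteristic_maximal_entropy (R : realType) (A : finType) (W : subshift A) :
  (forall N, exists k l, [/\ (N <= k)%N, (N <= l)%N &
     sft_cover W k = sft_cover W (k + l)]) ->
  exists mu : probability (borel_space W) R, characteristic_measure mu /\ maximal_entropy mu.
Proof.
move=> gaps; have [|m [m0 mT mU mpsi mH]] := @invariant_content R A W.
  by move=> N; have [k [l]] := gaps N; rewrite !sft_coverE; exists k, l.
have [mu muE] := content_extension m0 mT mU.
have muA : characteristic_measure mu.
  move=> psi psiA; apply: invariant_of_window => // C Cw.
  by rewrite !muE ?mpsi//; exact: automorphism_window_set.
exists mu; split=> //; apply: maximal_entropy_of_cylinders => [|q q0].
  exact/muA/shift_automorphism.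
apply: (le_trans (mH q q0)); rewrite le_eqVlt; apply/orP; left; apply/eqP.
by congr (_ / _); apply: eq_bigr => w _; rewrite muE//; exact: window_cylinder.
Qed.

Theorem corollary6p15 (R : realType) (alpha : R) (beta : nat -> R)
    (i j : nat -> nat) (X : subshift bool)
    (alpha01 : 0 < alpha < 1)
    (alpha_irr : irrational alpha)
    (beta_orbit : forall n, exists2 m : nat,
       (1 <= m)%N & beta n = mod1 (m%:R * alpha))
    (beta_incr : {homo beta : m n / (m < n)%N >-> m < n})
    (beta_lim : beta n @[n --> \oo] --> alpha)
    (Z_stable : language_stable R (union_subshift alpha beta))
    (i_pos : forall n, (1 <= i n)%N)
    (i_incr : {homo i : m n / (m < n)%N})
    (j_incr : {homo j : m n / (m < n)%N})
    (Z_cover : forall n, sft_cover (union_subshift alpha beta) (i n) =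
                         sft_cover (union_subshift alpha beta) (i n + j n))
    (X_stable : language_stable R X)
    (X_minimal : minimal_subshift X)
    (X_entropy : 0 < htop R X)
    (X_cover : infinite_set
       [set n | sft_cover X (i n) = sft_cover X (i n + j n)])
    (XZc_minimal : minimal_subshift (prod_subshift X (rotation_subshift alpha alpha)))
    (XZj_minimal : forall n,
       minimal_subshift (prod_subshift X (rotation_subshift alpha (beta n)))) :
  let W := prod_subshift (prod_subshift X full2) (union_subshift alpha beta) in
  (exists mu : probability (borel_space W) R, characteristic_measure mu) /\
  (exists mu : probability (borel_space W) R,
     characteristic_measure mu /\ maximal_entropy mu).
Proof.
move=> W.
have [mu [muA muE]] : exists mu : probability (borel_space W) R,
    characteristic_measure mu /\ maximal_entropy mu.
  apply: characteristic_maximal_entropy => N.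
  have id_le (h : nat -> nat) : {homo h : m n / (m < n)%N} -> forall n, (n <= h n)%N.
    by move=> hh; elim=> // n IH; exact: leq_ltn_trans IH (hh _ _ (ltnSn n)).
  (* The blocks of [Z] are constant for every index, so an index that is good for [X] is good for
     [W]; infinitely many of them allow one beyond [N], where [i n] and [j n] are at least [N]. *)
  have [n Xn Nn] : exists2 n,
      [set n | sft_cover X (i n) = sft_cover X (i n + j n)] n & (N <= n)%N.
    apply: contrapT => nS; apply: X_cover; apply: (sub_finite_set _ (finite_II N)) => n Xn.
    by rewrite /= ltnNge; apply/negP => Nn; apply: nS; exists n.
  exists (i n), (j n); split.
  - exact: leq_trans Nn (id_le i i_incr n).
  - exact: leq_trans Nn (id_le j j_incr n).
  have {}Xn : sft_cover X (i n) = sft_cover X (i n + j n) := Xn.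
  move: Xn (Z_cover n); rewrite !sft_coverE => Xn Zn.
  by rewrite !cover_prod Xn Zn !cover_full2.
by split; exists mu.
Qed.
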